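(* Assume (H0), (H0'), (H1), (H2), and let $2\le p\le\infty$. Let $f\in L^p(\Omega)$ and let $u\in\mathcal{H}_{J,0}(\Omega)$ be the weak solution of $\mathfrak{L}u=f$ in $\Omega$, $u=0$ in $\Omega^c$. Then $\|u\|_{L^p(\Omega)}\le C\|f\|_{L^p(\Omega)}$ with $C$ depending only on the kernel $J$ and on $\Omega$.
   Context: Standing setting: $N\ge1$, $\Omega\subset\mathbb{R}^N$ bounded open, $B_\varepsilon=\{|z|<\varepsilon\}$. (H0): $J:\mathbb{R}^N\times\mathbb{R}^N\to[0,\infty)$ measurable, symmetric, $\sup_x\int\min(1,|x-y|^2)J(x,y)\,dy<\infty$. (H0'): $J(x,y)\ge\mathcal{K}(x-y)\ge0$ with $\mathcal{K}\notin L^1(B_\varepsilon)$ for all $\varepsilon>0$. (H1): there exist $\rho>0$ and $\ell:(0,\rho)\to(0,\infty)$, bounded above and below by positive constants on $[\varepsilon,\rho)$ for every $\varepsilon\in(0,\rho)$, with $\mathcal{K}(z)=|z|^{-N}\ell(|z|)$ for $0<|z|<\rho$ and $M(r):=\int_r^\rho\ell(s)/s\,ds\to\infty$ as $r\to0^+$. (H2): $\lim_{s\to0^+}\ell(\lambda s)/\ell(s)=1$ for all $\lambda>0$. $Q_\Omega=(\Omega^c\times\Omega^c)^c$, $\mathcal{E}(u,v)=\frac12\iint_{Q_\Omega}(u(x)-u(y))(v(x)-v(y))J(x,y)\,dx\,dy$; $\mathcal{H}_{J,0}(\Omega)$ is the set of measurable $u$ with $u|_\Omega\in L^2(\Omega)$,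 $\mathcal{E}(u,u)<\infty$, $u=0$ a.e. on $\Omega^c$. A weak solution of $\mathfrak{L}u=f$ in $\Omega$, $u=0$ in $\Omega^c$ is $u\in\mathcal{H}_{J,0}(\Omega)$ with $\mathcal{E}(u,\phi)=\int_\Omega f\phi$ for all $\phi\in\mathcal{H}_{J,0}(\Omega)$ (it exists and is unique). *)

(* Defs.v *)
From HB Require Import structures.
From mathcomp Require Import all_boot all_order all_algebra.
From mathcomp Require Import all_classical all_reals all_analysis.
Set Implicit Arguments. Unset Strict Implicit. Unset Printing Implicit Defensive.
Import Order.TTheory GRing.Theory Num.Theory.
Import numFieldNormedType.Exports.
Local Open Scope classical_set_scope.
Local Open Scope ring_scope.

(** Points of R^N are N-tuples of reals, equipped with the product (Borel)
    sigma-algebra provided by MathComp-Analysis (measure_tuple_display). *)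
Section Defs.
Context {R : realType} {N : nat}.

Definition vsub (x y : N.-tuple R) : N.-tuple R :=
  [tuple tnth x i - tnth y i | i < N].

Definition enorm (x : N.-tuple R) : R :=
  Num.sqrt (\sum_(i < N) tnth x i ^+ 2).

Definition eball0 (e : R) : set (N.-tuple R) := [set z | enorm z < e].

Definition eopen (O : set (N.-tuple R)) : Prop :=
  forall x, O x -> exists2 r : R, 0 < r &
    forall y, enorm (vsub y x) < r -> O y.

Definition ebounded (O : set (N.-tuple R)) : Prop :=
  exists M : R, forall x, O x -> enorm x <= M.

(** lam is (the Borel restriction of) Lebesgue measure on R^N: it gives every
    half-open box its volume.  By uniqueness of measure extension this
    characterizes Lebesgue measure on the Borel sigma-algebra. *)
Definition is_lebesgue_measure (lam : {measure set (N.-tuple R) -> \bar R}) : Prop :=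
  forall a b : N.-tuple R, (forall i, tnth a i <= tnth b i) ->
    lam [set x | forall i, tnth a i <= tnth x i < tnth b i] =
    (\prod_(i < N) (tnth b i - tnth a i))%:E.

Variable lam : {sigma_finite_measure set (N.-tuple R) -> \bar R}.

Definition LpnormOn (Om : set (N.-tuple R)) (p : \bar R) (g : N.-tuple R -> R) : \bar R :=
  Lnorm lam p (fun x => (if x \in Om then g x else 0)%:E).

Definition in_Lp (Om : set (N.-tuple R)) (p : \bar R) (g : N.-tuple R -> R) : Prop :=
  measurable_fun Om g /\ (LpnormOn Om p g < +oo)%E.

Definition QOmega (Om : set (N.-tuple R)) : set (N.-tuple R * N.-tuple R) :=
  [set z | Om z.1 \/ Om z.2].

Definition energy (J : N.-tuple R -> N.-tuple R -> R) (Om : set (N.-tuple R))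
    (u v : N.-tuple R -> R) : \bar R :=
  ((2^-1)%:E *
   \int[(lam \x lam)%E]_(z in QOmega Om)
      ((u z.1 - u z.2) * (v z.1 - v z.2) * J z.1 z.2)%:E)%E.

Definition HJ0 (J : N.-tuple R -> N.-tuple R -> R) (Om : set (N.-tuple R))
    (u : N.-tuple R -> R) : Prop :=
  [/\ measurable_fun setT u,
      (LpnormOn Om 2%:E u < +oo)%E,
      (energy J Om u u < +oo)%E &
      {ae lam, forall x, ~ Om x -> u x = 0}].

Definition weak_solution (J : N.-tuple R -> N.-tuple R -> R) (Om : set (N.-tuple R))
    (f u : N.-tuple R -> R) : Prop :=
  HJ0 J Om u /\
  forall phi, HJ0 J Om phi ->
    energy J Om u phi = (\int[lam]_(x in Om) (f x * phi x)%:E)%E.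

Definition H0 (J : N.-tuple R -> N.-tuple R -> R) : Prop :=
  [/\ measurable_fun setT (fun z : N.-tuple R * N.-tuple R => J z.1 z.2),
      (forall x y, 0 <= J x y),
      (forall x y, J x y = J y x) &
      exists C : R, forall x,
        (\int[lam]_y (Num.min 1 (enorm (vsub x y) ^+ 2) * J x y)%:E <= C%:E)%E].

Definition H0' (J : N.-tuple R -> N.-tuple R -> R) (K : N.-tuple R -> R) : Prop :=
  [/\ measurable_fun setT K,
      (forall z, 0 <= K z),
      (forall x y, K (vsub x y) <= J x y) &
      forall e : R, 0 < e -> ~ lam.-integrable (eball0 e) (EFin \o K)].

Definition H1 (K : N.-tuple R -> R) (rho : R) (ell : R -> R) : Prop :=
  [/\ 0 < rho,
      (forall s, 0 < s < rho -> 0 < ell s),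
      (forall e, 0 < e < rho -> exists c1 c2 : R,
         [/\ 0 < c1, 0 < c2 & forall s, e <= s < rho -> c1 <= ell s <= c2]),
      (forall z, 0 < enorm z < rho -> K z = enorm z ^- N * ell (enorm z)) &
      measurable_fun `]0, rho[ ell /\
      ((fun r => \int[@lebesgue_measure R]_(s in `[r, rho[) (ell s / s)%:E)
         @ 0^'+ --> +oo)%E].

Definition H2 (ell : R -> R) : Prop :=
  forall a : R, 0 < a -> (fun s => ell (a * s) / ell s) @ 0^'+ --> (1 : R).

Definition kernel_hyps (J : N.-tuple R -> N.-tuple R -> R) : Prop :=
  exists K : N.-tuple R -> R, H0' J K /\
    exists (rho : R) (ell : R -> R), H1 K rho ell /\ H2 ell.

End Defs.

(* Main.v *)
(** The kernel [K] is not integrable at the origin, so it dominates a bounded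
    kernel [k], supported away from [0], of total mass at least [3].  Translating
    [u] repeatedly along a vector of the support of [k] leaves [Om], which gives a
    Poincare inequality and hence [|u|_2 <= C |f|_2].  On the other hand, if the
    superlevel set [A = {|u| > t}] is so small that [k] keeps mass [2] off [A], the
    interaction of [A] with its complement acts as a zero-order term: for any
    nondecreasing Lipschitz [h] vanishing below [t], testing with the odd extension
    of [h] evaluated at [u] yields
      [\int (|u| - t)_+ h(|u|) <= \int |f| h(|u|)],
    with no constant depending on [h].  Choosing [h(s) = (s - t)_+ ^ (p - 1)]
    (truncated), or [h(s) = (s - t - |f|_oo)_+] when [p = +oo], bounds
    [(|u| - t)_+] in [L^p] by [f] uniformly in [p]; Chebyshev's inequality and the
    [L^2] bound allow [t] to be a multiple of [|f|_p]. *)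
Require Import Defs.
From HB Require Import structures.
From mathcomp Require Import all_boot all_order all_algebra.
From mathcomp Require Import all_classical all_reals all_analysis.
From mathcomp Require Import measurable_realfun ess_sup_inf ring lra.
Import Order.TTheory GRing.Theory Num.Theory.
Import numFieldNormedType.Exports.
Local Open Scope classical_set_scope.
Local Open Scope ring_scope.

(** * Lebesgue measure on tuples *)

Section EuclideanMeasure.
Set Implicit Arguments. Unset Strict Implicit.
Context {R : realType} {N : nat}.
Implicit Types (x y z : N.-tuple R).

Definition vadd x y : N.-tuple R := [tuple tnth x i + tnth y i | i < N].

Definition box (a b : N.-tuple R) : set (N.-tuple R) :=
  [set x | forall i, tnth a i <= tnth x i < tnth b i].

Lemma measurable_mktuple d (T : measurableType d) (f : 'I_N -> T -> R) :
  (forall i, measurable_fun setT (f i)) ->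
  measurable_fun setT (fun t => [tuple f i t | i < N] : N.-tuple R).
Proof.
move=> mf; apply/measurable_fun_tnthP => i.
by apply: eq_measurable_fun (mf i) => t _ /=; rewrite tnth_mktuple.
Qed.

Lemma measurable_coord d (T : measurableType d) (f : T -> N.-tuple R) i :
  measurable_fun setT f -> measurable_fun setT (fun t => tnth (f t) i).
Proof. by move=> mf; exact: (measurableT_comp (measurable_tnth i)). Qed.

Lemma measurable_vadd d (T : measurableType d) (f g : T -> N.-tuple R) :
  measurable_fun setT f -> measurable_fun setT g ->
  measurable_fun setT (fun t => vadd (f t) (g t)).
Proof.
move=> mf mg; apply: measurable_mktuple => i.
by apply: measurable_funD; exact: measurable_coord.
Qed.

Lemma measurable_vsub d (T : measurableType d) (f g : T -> N.-tuple R) :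
  measurable_fun setT f -> measurable_fun setT g ->
  measurable_fun setT (fun t => vsub (f t) (g t)).
Proof.
move=> mf mg; apply: measurable_mktuple => i.
by apply: measurable_funB; exact: measurable_coord.
Qed.

Lemma measurable_enorm : measurable_fun setT (@enorm R N).
Proof.
apply: (@measurableT_comp _ _ _ _ _ _ (@Num.sqrt R)).
  by apply: nondecreasing_measurable => // a b; exact: ler_wsqrtr.
apply: measurable_sum => i; apply: measurable_funX.
exact: measurable_coord.
Qed.

Lemma enorm_coord x i : `|tnth x i| <= enorm x.
Proof.
rewrite -sqrtr_sqr ler_wsqrtr// (bigD1 i)//= lerDl sumr_ge0// => j _.
exact: sqr_ge0.
Qed.

(** The sum of squares is at most [N e^2 <= (N e)^2], so the crude factor [N] can stand for its
    square root. *)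
Lemma enorm_le x (e : R) : 0 <= e -> (forall i, `|tnth x i| <= e) ->
  enorm x <= N%:R * e.
Proof.
move=> e0 xe.
have Ne0 : 0 <= N%:R * e by rewrite mulr_ge0.
rewrite -[leRHS]ger0_norm// -sqrtr_sqr ler_wsqrtr// exprMn.
apply: (@le_trans _ _ (\sum_(i < N) e ^+ 2)).
  apply: ler_sum => i _; rewrite -[tnth x i ^+ 2]real_normK ?num_real//.
  by rewrite lerXn2r ?nnegrE.
rewrite sumr_const card_ord -[leLHS]mulr_natl; apply: ler_wpM2r.
  exact: sqr_ge0.
by case: N => [|n]; rewrite ?expr0n// ler_eXnr// ler1n.
Qed.

Lemma measurable_box a b : measurable (box a b).
Proof.
have -> : box a b = \bigcap_(i in [set: 'I_N])
    ((fun x => tnth x i) @^-1` `[tnth a i, tnth b i[).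
  apply/seteqP; split=> x /= xab i; last by have := xab i I; rewrite /= in_itv.
  by move=> _ /=; rewrite in_itv /=; exact: xab.
apply: fin_bigcap_measurable => [|i _]; first exact: finite_finset.
rewrite -[X in measurable X]setTI; apply: measurable_tnth => //.
Qed.

(** Every point of [O] lies in a cube with rational centre and half-side [1/(n+1)] that stays inside
    [O]. There are countably many such cubes. *)
Lemma measurable_eopen (O : set (N.-tuple R)) : eopen O -> measurable O.
Proof.
move=> oO.
pose B (q : N.-tuple rat * nat) := box
  [tuple ratr (tnth q.1 i) - q.2.+1%:R^-1 | i < N]
  [tuple ratr (tnth q.1 i) + q.2.+1%:R^-1 | i < N].
have -> : O = \bigcup_(q in setT) (if `[< B q `<=` O >] then B q else set0).
  apply/seteqP; split=> [x Ox|x [q _]]; last first.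
    by case: asboolP => // BO Bx; exact: BO.
  have [r r0 rO] := oO _ Ox.
  (* Two points of a cube of half-side below [e] differ by at most [2e] in each coordinate, and
     [N * (2e) < r]; using [N.+1] makes this inequality strict. *)
  have e0 : 0 < r / N.+1%:R / 2 by rewrite !divr_gt0.
  set e := r / N.+1%:R / 2 in e0.
  have [n _ ne] := near_infty_natSinv_lt (PosNum e0).
  have {}ne := ne n (leqnn n); rewrite /= in ne.
  have n0 : 0 < n.+1%:R^-1 :> R by rewrite invr_gt0.
  have [d dE] : exists d : R, d = n.+1%:R^-1 by exists n.+1%:R^-1.
  rewrite -dE in ne n0.
  have /choice [q qP] i : exists q : rat,
      ratr q \in `]tnth x i - d, tnth x i + d[.
    by apply: rat_in_itvoo; rewrite ltrBlDr -addrA ltrDl addr_gt0.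
  exists ([tuple q i | i < N], n) => //.
  case: asboolP => [_|].
    move=> i; rewrite !tnth_mktuple /= -dE; have := qP i.
    by rewrite in_itv/= => /andP[h1 h2]; apply/andP; split; lra.
  case=> y Bqy; apply: rO => //.
  apply: (@le_lt_trans _ _ (N%:R * (e * 2))).
    apply: enorm_le => [|i]; first lra.
    move: (qP i) (Bqy i); rewrite !tnth_mktuple in_itv/= -dE => /andP[? ?] /andP[? ?].
    by rewrite ler_norml; apply/andP; split; lra.
  by rewrite /e divfK// mulrCA gtr_pMr// ltr_pdivrMr// mul1r ltr_nat.
apply: countable_bigcupT_measurable => // q.
by case: asboolP => _ //; exact: measurable_box.
Qed.

Lemma measurable_origin : measurable [set [tuple (0 : R) | i < N]].
Proof.
have -> : [set [tuple 0 | i < N]] =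
    \bigcap_(i in [set: 'I_N]) ((fun x => tnth x i) @^-1` [set (0 : R)]).
  apply/seteqP; split=> [x /= -> i _|x /= h]; first by rewrite /= tnth_mktuple.
  by apply: eq_from_tnth => i; rewrite tnth_mktuple; exact: h.
apply: fin_bigcap_measurable => [|i _]; first exact: finite_finset.
by rewrite -[X in measurable X]setTI; apply: measurable_tnth.
Qed.

Lemma box_setI_closed : setI_closed (range (fun ab : N.-tuple R * N.-tuple R => box ab.1 ab.2)).
Proof.
move=> _ _ [[a b] _ <-] [[c d] _ <-] /=.
exists ([tuple Num.max (tnth a i) (tnth c i) | i < N],
        [tuple Num.min (tnth b i) (tnth d i) | i < N]) => //=.
apply/seteqP; split=> [x h|x [h1 h2] i].
  by split=> i; move: (h i); rewrite !tnth_mktuple ge_max lt_min;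
    case/andP=> /andP[? ?] /andP[? ?]; apply/andP.
rewrite !tnth_mktuple ge_max lt_min.
by case/andP: (h1 i) => -> ->; case/andP: (h2 i) => -> ->.
Qed.

Definition cube (n : nat) : set (N.-tuple R) :=
  box [tuple - n%:R | i < N] [tuple n%:R | i < N].

Lemma cubeP (n : nat) x : (forall i, `|tnth x i| < n%:R) -> cube n x.
Proof.
move=> h i; rewrite !tnth_mktuple; have := h i.
by rewrite ltr_norml => /andP[/ltW -> ->].
Qed.

Lemma exists_coord_bound x : exists n : nat, forall m, (n <= m)%N ->
  forall i, `|tnth x i| < m%:R.
Proof.
exists (Num.truncn (enorm x)).+1 => m nm i.
apply: le_lt_trans (enorm_coord x i) _.
apply: lt_le_trans (truncnS_gt _) _.
by rewrite ler_nat.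
Qed.

Lemma cube_cover : \bigcup_n cube n = setT.
Proof.
apply/seteqP; split=> // x _; have [n xn] := exists_coord_bound x.
by exists n => //; apply/cubeP/xn.
Qed.

(** For the inclusion from left to right, each half-space [c <= x_i] is a countable union of boxes
    that grow in all the other directions. With [box_setI_closed] this provides the generating
    pi-system for uniqueness of measures. *)
Lemma measurable_tuple_boxes :
  @measurable _ (N.-tuple R) =
  <<s range (fun ab : N.-tuple R * N.-tuple R => box ab.1 ab.2) >>.
Proof.
set G := range _; apply/seteqP; split=> [A mA|A]; last first.
  apply: smallest_sub; first exact: sigma_algebra_measurable.
  by move=> _ [[a b] _ <-]; exact: measurable_box.
suff : measurable_fun [set: g_sigma_algebraType G] (id : g_sigma_algebraType G -> N.-tuple R).
  by move=> /(_ measurableT _ mA); rewrite setTI.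
apply/measurable_fun_tnthP => i.
apply: (measurability (@RGenCInfty.G R)) => [|_ [_ [c ->] <-]].
  exact: RGenCInfty.measurableE.
rewrite setTI.
pose a n : N.-tuple R := [tuple if j == i then c else - n%:R | j < N].
rewrite (_ : _ @^-1` _ = \bigcup_n box (a n) [tuple n%:R | j < N]); last first.
  apply/seteqP; split=> x /=; rewrite in_itv/= andbT; last first.
    by case=> n _ /(_ i); rewrite /a !tnth_mktuple eqxx => /andP[].
  move=> cx; have [n xn] := exists_coord_bound x; exists n => // j.
  rewrite /a !tnth_mktuple; have := xn n (leqnn n) j; rewrite ltr_norml.
  by case: eqP => [->|_] /andP[? ->]; rewrite ?cx// ltW.
apply: bigcupT_measurable => n; apply: sub_sigma_algebra.
by exists (a n, [tuple n%:R | j < N]).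
Qed.

(** * Translation invariance, the null origin and finiteness on bounded sets *)

Section Lebesgue.
Context (lam : {sigma_finite_measure set (N.-tuple R) -> \bar R}).
Hypothesis Hlam : is_lebesgue_measure lam.

Lemma box_empty a b i : tnth b i < tnth a i -> box a b = set0.
Proof.
move=> ba; apply/seteqP; split=> // x /(_ i) /andP[h1 h2].
by have := lt_le_trans (lt_trans h2 ba) h1; rewrite ltxx.
Qed.

Lemma lebesgue_cube_fin n : (lam (cube n) < +oo)%E.
Proof.
by rewrite /cube /box Hlam ?ltry// => i; rewrite !tnth_mktuple (@le_trans _ _ 0)// oppr_le0.
Qed.

(** The image of [lam] under the translation gives boxes the same volume as [lam]; boxes form a
    generating pi-system and the cubes exhaust the space with finite measure, so the two measures
    coincide. *)
Lemma lebesgue_translate (v : N.-tuple R) A : measurable A ->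
  lam (vadd v @^-1` A) = lam A.
Proof.
have mv : measurable_fun setT (vadd v) by apply: measurable_vadd.
pose m1 : {measure set (N.-tuple R) -> \bar R} := pushforward lam (vadd v).
move=> mA; apply: esym.
apply: (@measure_unique _ _ _ _ cube measurable_tuple_boxes box_setI_closed _ _
  lam (m1 mv)) => //.
- by move=> n; exists ([tuple - n%:R | i < N], [tuple n%:R | i < N]).
- exact: cube_cover.
- move=> _ [[a b] _ <-] /=; rewrite /m1 /pushforward.
  have -> : vadd v @^-1` box a b = box (vsub a v) (vsub b v).
    by apply/seteqP; split=> x /= xab i; move: (xab i);
      rewrite !tnth_mktuple lerBlDl ltrBrDl.
  (* [is_lebesgue_measure] speaks only of boxes with ordered corners; otherwise both boxes are
     empty. *)
  have [/forallP ab|] := boolP [forall i, tnth a i <= tnth b i].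
    rewrite /box !Hlam //; last by move=> i; rewrite !tnth_mktuple lerB.
    by congr EFin; apply: eq_bigr => i _; rewrite !tnth_mktuple opprB addrA subrK.
  rewrite negb_forall => /existsP[i]; rewrite -ltNge => ba.
  rewrite (box_empty ba) (@box_empty _ _ i) ?measure0//.
  by rewrite !tnth_mktuple ltrD2r.
- exact: lebesgue_cube_fin.
Qed.

Lemma ge0_integral_translate (v : N.-tuple R) (g : N.-tuple R -> \bar R) :
  measurable_fun setT g -> (forall x, 0 <= g x)%E ->
  (\int[lam]_x g (vadd v x) = \int[lam]_x g x)%E.
Proof.
move=> mg g0.
have mv : measurable_fun setT (vadd v) by apply: measurable_vadd.
transitivity (\int[pushforward lam (vadd v)]_x g x)%E.
  by rewrite ge0_integral_pushforward// => x _; exact: g0.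
apply: eq_measure_integral => A mA _; exact: lebesgue_translate.
Qed.

(** The origin lies in a cube of side [d = min(1, e)], of volume [d^N <= d <= e]. For [N = 0] the
    only point would have measure [1]. *)
Lemma lebesgue_origin : (1 <= N)%N -> lam [set [tuple 0 | i < N]] = 0%E.
Proof.
move=> N1; apply/eqP; rewrite eq_le measure_ge0 andbT.
apply/lee_addgt0Pr => e e0; rewrite add0e.
pose d := Num.min 1 e.
have d0 : 0 < d by rewrite lt_min ltr01.
apply: (@le_trans _ _ (lam (box [tuple 0 | i < N] [tuple d | i < N]))).
  apply: le_measure; rewrite ?inE.
  - exact: measurable_origin.
  - exact: measurable_box.
  - by move=> x /= -> i; rewrite !tnth_mktuple lexx.
rewrite /box Hlam => [|i]; last by rewrite !tnth_mktuple ltW.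
rewrite (eq_bigr (fun=> d)) => [|i _]; last by rewrite !tnth_mktuple subr0.
rewrite prodr_const card_ord lee_fin; apply: (@le_trans _ _ d).
  case: (N) N1 => // n _; rewrite exprS; apply: ler_piMr; first exact: ltW.
  by apply: exprn_ile1; [exact: ltW|rewrite ge_min lexx].
by rewrite ge_min lexx orbT.
Qed.

Lemma lebesgue_bounded_fin A : measurable A -> ebounded A -> (lam A < +oo)%E.
Proof.
move=> mA [M AM]; pose n := (Num.truncn M).+1.
apply: le_lt_trans (lebesgue_cube_fin n).
apply: le_measure; rewrite ?inE//; first exact: measurable_box.
move=> x Ax; apply: cubeP => i; apply: le_lt_trans (enorm_coord x i) _.
by apply: le_lt_trans (AM _ Ax) _; exact: truncnS_gt.
Qed.

End Lebesgue.
End EuclideanMeasure.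

(** * Automation for measurability of explicit expressions *)

Ltac meas := repeat match goal with
  | H : measurable_fun ?D ?f |- measurable_fun ?D ?f => exact: H
  | |- measurable_fun _ (fun x => EFin _) => apply/measurable_EFinP
  | |- measurable_fun _ (fun x => @?f x + @?g x) => apply: measurable_funD
  | |- measurable_fun _ (fun x => - @?f x) => apply: measurable_funN
  | |- measurable_fun _ (fun x => @?f x * @?g x) => apply: measurable_funM
  | |- measurable_fun _ (fun x => @?f x ^+ _) => apply: measurable_funX
  | |- measurable_fun _ (fun x => Num.max (@?f x) (@?g x)) => apply: measurable_maxr
  | |- measurable_fun _ (fun x => Num.min (@?f x) (@?g x)) => apply: measurable_minr
  | |- measurable_fun _ (fun x => `| @?f x |) => apply: (measurableT_comp (@normr_measurable _ _))
  | |- measurable_fun _ (fun x => (@?f x) `^ ?p) => apply: (measurableT_comp (@measurable_powR _ p))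
  | |- measurable_fun _ (fun x => vadd (@?f x) (@?g x)) => apply: measurable_vadd
  | |- measurable_fun _ (fun x => vsub (@?f x) (@?g x)) => apply: measurable_vsub
  | |- measurable_fun _ (vadd ?z) => apply: measurable_vadd
  | |- measurable_fun _ (vsub ?z) => apply: measurable_vsub
  | |- measurable_fun _ fst => exact: measurable_fst
  | |- measurable_fun _ snd => exact: measurable_snd
  | |- measurable_fun _ id => exact: measurable_id
  | |- measurable_fun _ (EFin \o _) => apply/measurable_EFinP
  | |- measurable_fun _ (fun x => fst x) => exact: measurable_fst
  | |- measurable_fun _ (fun x => snd x) => exact: measurable_snd
  | |- measurable_fun _ (fun x => x) => exact: measurable_id
  | |- measurable_fun _ (fun x => ?c) => exact: measurable_cst
  | H : measurable_fun setT ?w |- measurable_fun _ (fun x => ?w (@?f x)) =>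
      apply: (measurableT_comp H)
  end.

(** * Integrals of nonnegative real-valued functions *)

Section RealIntegrals.
Set Implicit Arguments. Unset Strict Implicit.
Context d (T : measurableType d) (R : realType) (mu : {measure set T -> \bar R}).
Implicit Types (f g : T -> R) (D : set T).

Lemma measurable_norm_gt f (t : R) : measurable_fun setT f ->
  measurable [set x | t < `|f x|].
Proof.
move=> mf; have mnf : measurable_fun setT (fun x => `|f x|) by meas.
have := mnf measurableT `]t, +oo[%classic (measurable_itv _); rewrite setTI.
by congr measurable; apply/seteqP; split=> x; rewrite /= in_itv/= andbT.
Qed.

Lemma nneg_le_integral D f g : measurable D -> measurable_fun D f -> measurable_fun D g ->
  (forall x, D x -> 0 <= f x) -> (forall x, D x -> f x <= g x) ->
  (\int[mu]_(x in D) (f x)%:E <= \int[mu]_(x in D) (g x)%:E)%E.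
Proof.
move=> mD mf mg f0 fg; apply: ge0_le_integral => //; try exact/measurable_EFinP.
Qed.

Lemma nneg_integralZ c f : measurable_fun setT f -> (forall x, 0 <= f x) -> 0 <= c ->
  (\int[mu]_x (c * f x)%:E = c%:E * \int[mu]_x (f x)%:E)%E.
Proof.
move=> mf f0 c0; under eq_integral do rewrite EFinM.
by rewrite ge0_integralZl//; [exact/measurable_EFinP|move=> x _; rewrite lee_fin].
Qed.

Lemma nneg_integralD f g : measurable_fun setT f -> measurable_fun setT g ->
  (forall x, 0 <= f x) -> (forall x, 0 <= g x) ->
  (\int[mu]_x (f x + g x)%:E = \int[mu]_x (f x)%:E + \int[mu]_x (g x)%:E)%E.
Proof.
move=> mf mg f0 g0; under eq_integral do rewrite EFinD.
rewrite ge0_integralD//; try exact/measurable_EFinP.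
- by move=> x _; rewrite lee_fin.
- by move=> x _; rewrite lee_fin.
Qed.

End RealIntegrals.

(** * A bounded piece of the kernel with large mass, away from the origin *)

Section Kernel.
Set Implicit Arguments. Unset Strict Implicit.
Context {R : realType} {N : nat}.
Context (lam : {sigma_finite_measure set (N.-tuple R) -> \bar R}).
Hypothesis Hlam : is_lebesgue_measure lam.
Hypothesis N_ge1 : (1 <= N)%N.
Implicit Types (x y z : N.-tuple R).

(** The sets [F n] below increase to the punctured unit ball, where [K] has infinite integral, so by
    monotone convergence some [F n] carries mass [c]. The bound [n] makes small sets carry little
    mass; the distance from [0] lets iterated translations leave a bounded set. *)
Lemma exists_kernel_core (K : N.-tuple R -> R) (c : R) :
  measurable_fun setT K -> (forall z, 0 <= K z) ->
  ~ lam.-integrable (eball0 1) (EFin \o K) ->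
  exists (n : nat) (D : set (N.-tuple R)), [/\ measurable D,
    forall z, D z -> K z <= n%:R,
    forall z, D z -> exists i, n.+1%:R^-1 <= `|tnth z i| &
    (c%:E <= \int[lam]_(z in D) (K z)%:E)%E].
Proof.
move=> mK K0 Kint.
have mball : measurable (eball0 1 : set (N.-tuple R)).
  have := @measurable_enorm R N measurableT `]-oo, (1:R)[%classic (measurable_itv _).
  rewrite setTI; congr measurable; apply/seteqP; split=> x /=; by rewrite in_itv.
pose E n := [set z : N.-tuple R | exists i, n.+1%:R^-1 <= `|tnth z i| ].
have mE n : measurable (E n).
  have -> : E n = \bigcup_(i in [set: 'I_N]) ((fun z => `|tnth z i|) @^-1` `[n.+1%:R^-1, +oo[).
    apply/seteqP; split=> [z [i h]|z [i _]]; last by rewrite /= in_itv/= andbT => h; exists i.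
    by exists i => //=; rewrite in_itv/= h.
  apply: fin_bigcup_measurable => [|i _]; first exact: finite_finset.
  rewrite -[X in measurable X]setTI.
  suff : measurable_fun setT (fun z : N.-tuple R => `|tnth z i|) by apply.
  by apply: (measurableT_comp (@normr_measurable _ _)); exact: measurable_coord.
pose F n := eball0 1 `&` (K @^-1` `]-oo, n%:R]) `&` E n.
have mF n : measurable (F n).
  apply: measurableI => //; apply: measurableI => //.
  by rewrite -[X in measurable X]setTI; exact: mK.
have ndF : nondecreasing_seq F.
  move=> m n mn; rewrite subsetEset => z [[zb]]; rewrite /= in_itv/= => Km [i Ei].
  split; [split=> //=|].
    by rewrite in_itv/= (le_trans Km)// ler_nat.
  exists i; apply: le_trans Ei; rewrite lef_pV2 ?posrE//.
  by rewrite ler_nat.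
have UF : \bigcup_n F n = eball0 1 `\` [set [tuple 0 | i < N]].
  apply/seteqP; split=> [z [n _ [[zb _] [i zi]]]|z [zb z0]].
    split=> //= zE; move: zi; rewrite zE tnth_mktuple normr0.
    by rewrite leNgt invr_gt0 ltr0n.
  have [i zi0] : exists i, tnth z i != 0.
    apply: contra_notP z0 => /forallNP h /=; apply: eq_from_tnth => i.
    by rewrite tnth_mktuple; have := h i; case: eqP.
  have zi : 0 < `|tnth z i| by rewrite normr_gt0.
  have [n1 _ n1P] := near_infty_natSinv_lt (PosNum zi).
  pose n := maxn n1 (Num.truncn (K z)).+1.
  exists n => //; split; [split=> //=|].
    rewrite in_itv/= ltW// (lt_le_trans (truncnS_gt _))// ler_nat.
    exact: leq_maxr.
  by exists i; apply: ltW; apply: (n1P n); exact: leq_maxl.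
have mKE (D : set (N.-tuple R)) : measurable_fun D (EFin \o K).
  by apply: measurable_funTS; exact/measurable_EFinP.
have K0E n z (_ : F n z) : (0 <= (EFin \o K) z)%E by rewrite lee_fin.
have := @ge0_nondecreasing_set_cvg_integral _ _ _ F (EFin \o K) lam ndF mF
  (fun n => mKE _) K0E.
have {}Kint : (\int[lam]_(z in eball0 1) (EFin \o K) z = +oo)%E.
  apply/eqP; apply: contra_notT Kint; rewrite -ltey => Kfin.
  apply/integrableP; split => //; apply: le_lt_trans Kfin.
  rewrite le_eqVlt; apply/orP; left; apply/eqP; apply: eq_integral => z _ /=.
  by rewrite ger0_norm.
(* Removing the origin, a null set, keeps the integral infinite. *)
rewrite UF (_ : integral _ (_ `\` _) _ = +oo%E); last first.
  rewrite -Kint; apply: esym; apply: ge0_negligible_integral => //.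
  - exact: measurable_origin.
  - by move=> z _; rewrite lee_fin.
  - exact: lebesgue_origin.
move=> /cvgeyPge /(_ c) [n _ nP].
exists n, (F n); split=> //.
- by move=> z [[_]]; rewrite /= in_itv.
- by move=> z [].
- exact: (nP n (leqnn n)).
Qed.

End Kernel.

(** * Poincare inequality *)

Section Poincare.
Set Implicit Arguments. Unset Strict Implicit.
Context {R : realType} {N : nat}.
Context (lam : {sigma_finite_measure set (N.-tuple R) -> \bar R}).
Hypothesis Hlam : is_lebesgue_measure lam.
Implicit Types (x y z : N.-tuple R) (w : N.-tuple R -> R).

(** The vector [2^j z], built by doublings so that [shift_energy_double] can be iterated. *)
Definition dyadic z (j : nat) : N.-tuple R := iter j (fun v => vadd v v) z.

Lemma tnth_dyadic z j i : tnth (dyadic z j) i = 2 ^+ j * tnth z i.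
Proof.
elim: j => [|j IH] /=; first by rewrite mul1r.
by rewrite tnth_mktuple IH exprS; lra.
Qed.

Definition shift_energy w z : \bar R :=
  (\int[lam]_x ((w (vadd z x) - w x) ^+ 2)%:E)%E.

Lemma shift_energy_ge0 w z : (0 <= shift_energy w z)%E.
Proof. by apply: integral_ge0 => x _; rewrite lee_fin sqr_ge0. Qed.

(** The increment along [2z] is the sum of two increments along [z], and
    [(a + b)^2 <= 2 a^2 + 2 b^2]. By translation invariance both squares have the same integral. *)
Lemma shift_energy_double w z : measurable_fun setT w ->
  (shift_energy w (vadd z z) <= 4%:E * shift_energy w z)%E.
Proof.
move=> mw.
have mD : measurable_fun setT (fun x => (w (vadd z x) - w x) ^+ 2) by meas.
have mD' : measurable_fun setT
    (fun x => (w (vadd z (vadd z x)) - w (vadd z x)) ^+ 2) by meas.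
apply: (@le_trans _ _ (\int[lam]_x
    (2 * (w (vadd z (vadd z x)) - w (vadd z x)) ^+ 2 +
     2 * (w (vadd z x) - w x) ^+ 2)%:E)%E).
  apply: nneg_le_integral => //; [by meas|by meas|by move=> *; exact: sqr_ge0|].
  move=> x _.
  have -> : vadd (vadd z z) x = vadd z (vadd z x).
    by apply: eq_from_tnth => i; rewrite !tnth_mktuple addrA.
  by rewrite -subr_ge0; set a := w _; set b := w _; set c := w _;
    rewrite [leRHS](_ : _ = (a + c - 2 * b) ^+ 2) ?sqr_ge0//; ring.
rewrite nneg_integralD; [|by meas|by meas|by move=> x; rewrite mulr_ge0// sqr_ge0..].
rewrite !nneg_integralZ//; try by move=> x; exact: sqr_ge0.
rewrite (@ge0_integral_translate _ _ _ Hlam z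
  (fun x => ((w (vadd z x) - w x) ^+ 2)%:E)); first last.
- by move=> x; rewrite lee_fin sqr_ge0.
- exact/measurable_EFinP.
rewrite -/(shift_energy w z) -ge0_muleDl ?lee_fin// -EFinD.
by rewrite (_ : 2 + 2 = 4 :> R)//; lra.
Qed.

Lemma shift_energy_dyadic w z j : measurable_fun setT w ->
  (shift_energy w (dyadic z j) <= (4 ^+ j)%:E * shift_energy w z)%E.
Proof.
move=> mw; elim: j => [|j IH]; first by rewrite mul1e.
apply: le_trans (shift_energy_double _ mw) _.
by rewrite exprS EFinM -muleA lee_pmul2l.
Qed.

(** Tonelli's theorem followed, for fixed [x], by the substitution [z = y - x]. The right-hand side
    is the form that is comparable with the nonlocal energy. *)
Lemma shift_energy_change_of_variables w (k : N.-tuple R -> R) :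
  measurable_fun setT w -> measurable_fun setT k -> (forall z, 0 <= k z) ->
  (\int[lam]_z ((k z)%:E * shift_energy w z) =
   \int[lam]_x \int[lam]_y ((w x - w y) ^+ 2 * k (vsub y x))%:E)%E.
Proof.
move=> mw mk k0.
have mF : measurable_fun setT (fun p : N.-tuple R * N.-tuple R =>
    k p.1 * (w (vadd p.1 p.2) - w p.2) ^+ 2) by meas.
have F0 p : (0 <= (k p.1 * (w (vadd p.1 p.2) - w p.2) ^+ 2)%:E)%E.
  by rewrite lee_fin mulr_ge0// sqr_ge0.
transitivity (\int[lam]_z \int[lam]_x (k z * (w (vadd z x) - w x) ^+ 2)%:E)%E.
  apply: eq_integral => z _; rewrite nneg_integralZ//; first by meas.
  by move=> x; exact: sqr_ge0.
rewrite (@fubini_tonelli _ _ _ _ _ lam lam (fun p : N.-tuple R * N.-tuple R =>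
   (k p.1 * (w (vadd p.1 p.2) - w p.2) ^+ 2)%:E))//; last by apply/measurable_EFinP.
apply: eq_integral => x _.
rewrite -(@ge0_integral_translate _ _ _ Hlam [tuple - tnth x i | i < N]
  (fun z => (k z * (w (vadd z x) - w x) ^+ 2)%:E)) /=; first last.
- by move=> z; exact: (F0 (z, x)).
- by meas.
apply: eq_integral => y _; congr EFin.
have -> : vadd [tuple - tnth x i | i < N] y = vsub y x.
  by apply: eq_from_tnth => i; rewrite !tnth_mktuple addrC.
have -> : vadd (vsub y x) x = y.
  by apply: eq_from_tnth => i; rewrite !tnth_mktuple subrK.
by ring.
Qed.

(** If [2^j z] moves [Om] off itself, then of [x] and [x + 2^j z] at most one lies in [Om], so the
    squared norm of [w] is at most its shift energy along [2^j z], hence at most [4^j] times the one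
    along [z]. Integrating against [k] concludes. The constant is chosen before [k] and [w]. *)
Lemma poincare (Om D : set (N.-tuple R)) (n : nat) : measurable Om -> ebounded Om ->
  (forall z, D z -> exists i, n.+1%:R^-1 <= `|tnth z i|) ->
  exists2 C : R, 0 < C &
    forall (k w : N.-tuple R -> R), measurable_fun setT k -> (forall z, 0 <= k z) ->
    (forall z, ~ D z -> k z = 0) ->
    measurable_fun setT w -> (forall x, ~ Om x -> w x = 0) ->
    (\int[lam]_x (w x ^+ 2)%:E * \int[lam]_z (k z)%:E <=
     C%:E * \int[lam]_x \int[lam]_y ((w x - w y) ^+ 2 * k (vsub y x))%:E)%E.
Proof.
move=> mOm [M OmM] Dn.
(* [2^j z] moves [Om] off itself for every [z] in [D]. *)
pose j := (Num.truncn (n.+1%:R * (2 * M))).+1.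
have jM : 2 * M < 2 ^+ j * n.+1%:R^-1.
  (* With [a = (n+1) * 2M], one has [a < truncn a + 1 = j <= 2^j]. *)
  rewrite ltr_pdivlMr// mulrC; apply: lt_le_trans (truncnS_gt _) _.
  by rewrite -natrX ler_nat ltnW// ltn_expl.
exists (4 ^+ j) => [|k w mk k0 kD mw w0]; first by rewrite exprn_gt0.
have I0 : (0 <= \int[lam]_x (w x ^+ 2)%:E)%E.
  by apply: integral_ge0 => x _; rewrite lee_fin sqr_ge0.
rewrite -shift_energy_change_of_variables//.
have mE : measurable_fun setT (fun z => (k z)%:E * shift_energy w z)%E.
  apply: emeasurable_funM; first by meas.
  apply: (@measurable_fun_fubini_tonelli_F _ _ _ _ _ lam
    (fun p : N.-tuple R * N.-tuple R => ((w (vadd p.1 p.2) - w p.2) ^+ 2)%:E)).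
  - by meas.
  - by move=> x; rewrite lee_fin sqr_ge0.
have E0 z : (0 <= (k z)%:E * shift_energy w z)%E.
  by rewrite mule_ge0 ?lee_fin ?shift_energy_ge0.
rewrite -[leRHS]ge0_integralZl//.
rewrite -[leLHS]ge0_integralZl//; [|by meas|by move=> z _; rewrite lee_fin].
apply: ge0_le_integral => //.
- by move=> z _; rewrite mule_ge0// lee_fin.
- by apply: emeasurable_funM => //; meas.
- by apply: emeasurable_funM => //; meas.
move=> z _; have [Dz|nDz] := pselect (D z); last first.
  by rewrite kD// mule0 mul0e mule0.
rewrite [leRHS]muleCA muleC lee_wpmul2l ?lee_fin//.
apply: le_trans (shift_energy_dyadic z j mw).
apply: nneg_le_integral => //; [by meas|by meas|by move=> *; exact: sqr_ge0|].
move=> x _; have [Ox|nOx] := pselect (Om x); last first.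
  by rewrite w0// expr0n/= sqr_ge0.
rewrite [w (vadd _ _)]w0 ?sub0r ?sqrrN// => Oy.
(* If [x] and its translate were both in [Om], their [i]-th coordinates would differ by at most
   [2M], against [jM]. *)
have [i zi] := Dn _ Dz.
have h1 : `|tnth x i| <= M by exact: le_trans (enorm_coord x i) (OmM _ Ox).
have := le_trans (enorm_coord _ i) (OmM _ Oy).
rewrite tnth_mktuple tnth_dyadic => h2.
have h3 : 2 ^+ j * `|tnth z i| <= 2 * M.
  have -> : 2 ^+ j * `|tnth z i| = `|2 ^+ j * tnth z i|.
    by rewrite normrM (@ger0_norm _ (2 ^+ j))// exprn_ge0.
  have -> : 2 ^+ j * tnth z i = (2 ^+ j * tnth z i + tnth x i) - tnth x i by lra.
  apply: le_trans (ler_normB _ _) _; lra.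
have : 2 ^+ j * n.+1%:R^-1 <= 2 ^+ j * `|tnth z i| by rewrite ler_wpM2l// exprn_ge0.
by move=> h4; have := lt_le_trans jM (le_trans h4 h3); rewrite ltxx.
Qed.

(** Since [k <= n], the set [A] receives at most [n * lam A <= 1] of a total mass of at least [3],
    wherever the kernel is centred. *)
Lemma kernel_mass_off_small_set (n : nat) (k : N.-tuple R -> R) (A : set (N.-tuple R)) x :
  measurable_fun setT k -> (forall z, 0 <= k z <= n%:R) ->
  (3%:E <= \int[lam]_z (k z)%:E)%E -> measurable A -> (n%:R%:E * lam A <= 1)%E ->
  (2%:E <= \int[lam]_y (\1_(~` A) y * k (vsub y x))%:E)%E.
Proof.
move=> mk k0n k3 mA An.
have k0 z : 0 <= k z by have /andP[] := k0n z.
have m1 (B : set (N.-tuple R)) : measurable B -> measurable_fun setT (\1_B : _ -> R).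
  by move=> mB; exact: measurable_indic.
have mA1 := m1 _ mA; have mA2 := m1 _ (measurableC mA).
have i0 (B : set (N.-tuple R)) y : 0 <= \1_B y :> R by rewrite indicE.
set I := integral _ _ _.
have I3 : (3%:E <= \int[lam]_y (\1_A y * k (vsub y x))%:E + I)%E.
  rewrite /I -nneg_integralD; [|by meas|by meas|by move=> y; rewrite mulr_ge0..].
  apply: le_trans k3 _.
  rewrite -(@ge0_integral_translate _ _ _ Hlam [tuple - tnth x i | i < N]
    (EFin \o k)); first last.
  - by move=> z; rewrite lee_fin.
  - by meas.
  rewrite le_eqVlt; apply/orP; left; apply/eqP; apply: eq_integral => y _.
  rewrite /= -mulrDl !indicE in_setC; congr EFin.
  rewrite (_ : _ + _ = 1) ?mul1r; last by case: (y \in A); rewrite ?addr0 ?add0r.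
  by congr k; apply: eq_from_tnth => i; rewrite !tnth_mktuple addrC.
have h : (\int[lam]_y (\1_A y * k (vsub y x))%:E <= 1)%E.
  apply: le_trans An.
  have -> : lam A = (\int[lam]_y (\1_A y)%:E)%E by rewrite integral_indic// setIT.
  rewrite -nneg_integralZ//.
  apply: nneg_le_integral => //; [by meas|by meas|by move=> y _; rewrite mulr_ge0|].
  move=> y _; rewrite mulrC ler_wpM2r//.
  by have /andP[] := k0n (vsub y x).
have I0 : (0 <= I)%E by apply: integral_ge0 => y _; rewrite lee_fin mulr_ge0.
have {h} := le_trans I3 (leeD2r _ h); clear I3; move: I I0 => [r _|_ _|//].
  by rewrite -EFinD !lee_fin; lra.
exact: leey.
Qed.

End Poincare.

(** * Truncated test functions *)

Section TestFunction.
Set Implicit Arguments. Unset Strict Implicit.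
Context {R : realType}.

(** For [h] vanishing on []-oo, t]] with [t >= 0], at most one of the two terms is nonzero and this
    is [sign(s) h(|s|)]. *)
Definition odd_ext (h : R -> R) (s : R) : R := h s - h (- s).

Context (h : R -> R) (t L : R).
Hypothesis t0 : 0 <= t.
Hypothesis h_nd : {homo h : a b / a <= b}.
Hypothesis h_t : forall s, s <= t -> h s = 0.
Hypothesis h_lip : forall a b, `|h a - h b| <= L * `|a - b|.

Lemma profile_ge0 s : 0 <= h s.
Proof.
have [st|/ltW ts] := leP s t; first by rewrite h_t.
by rewrite -(h_t (lexx t)); exact: h_nd.
Qed.

Lemma odd_ext_norm s : `|odd_ext h s| = h `|s|.
Proof.
have h0 := profile_ge0; have t0_ := t0; rewrite /odd_ext; have [s0|s0] := leP 0 s.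
  by rewrite [h (- s)]h_t; [rewrite subr0 !ger0_norm|lra].
rewrite [h s]h_t; last lra.
by rewrite sub0r normrN (ltr0_norm s0) ger0_norm.
Qed.

Lemma odd_ext0 s : `|s| <= t -> odd_ext h s = 0.
Proof. by move=> st; apply/eqP; rewrite -normr_eq0 odd_ext_norm h_t. Qed.

Lemma odd_ext_nd : {homo odd_ext h : a b / a <= b}.
Proof. by move=> a b ab; rewrite /odd_ext lerB// h_nd// lerN2. Qed.

Lemma odd_ext_monotone a b : 0 <= (a - b) * (odd_ext h a - odd_ext h b).
Proof.
have [ab|/ltW ba] := leP a b.
  by apply: mulr_le0; rewrite subr_le0// odd_ext_nd.
by apply: mulr_ge0; rewrite subr_ge0// odd_ext_nd.
Qed.

(** Each of the two terms of [odd_ext] contributes [L]. The squared form is the one that enters the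
    energy. *)
Lemma odd_ext_sqr_lip a b :
  (odd_ext h a - odd_ext h b) ^+ 2 <= (2 * L) ^+ 2 * (a - b) ^+ 2.
Proof.
rewrite -exprMn -[leLHS]real_normK ?num_real// -[leRHS]real_normK ?num_real//.
rewrite lerXn2r ?nnegrE//.
have h1 := h_lip a b.
have h2 : `|h (- b) - h (- a)| <= L * `|a - b|.
  by apply: le_trans (h_lip _ _) _; rewrite opprK addrC.
have h3 : `|odd_ext h a - odd_ext h b| <= 2 * (L * `|a - b|).
  have -> : odd_ext h a - odd_ext h b = (h a - h b) + (h (- b) - h (- a)).
    by rewrite /odd_ext; lra.
  by apply: le_trans (ler_normD _ _) _; rewrite mulr_natl mulr2n lerD.
apply: le_trans h3 _; rewrite mulrA [leRHS]normrM ler_wpM2r// ler_norm//.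
Qed.

(** Here [odd_ext h b = 0], while [a - b] has the sign of [odd_ext h a] and size at least [|a| - t]
    once [|a| > t]. This is where the nonlocal interaction yields a zero-order term. *)
Lemma odd_ext_gap a b : `|b| <= t ->
  Num.max (`|a| - t) 0 * h `|a| <= (a - b) * (odd_ext h a - odd_ext h b).
Proof.
have t0_ := t0; move=> bt; have [at_|ta] := leP `|a| t.
  by rewrite (h_t at_) mulr0 odd_ext_monotone.
rewrite (odd_ext0 bt) subr0 max_l; last by rewrite subr_ge0 ltW.
move: bt; rewrite ler_norml => /andP[b1 b2].
have h0 := profile_ge0 `|a|.
rewrite /odd_ext; move: ta h0; have [a0|a0] := leP 0 a;
  rewrite ?(ger0_norm a0) ?(ltr0_norm a0) => ta h0.
  by rewrite (h_t (s := - a)); [rewrite subr0 ler_wpM2r//; lra|lra].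
rewrite (h_t (s := a)); last lra.
by rewrite sub0r mulrN -mulNr ler_wpM2r//; lra.
Qed.

End TestFunction.

(** * Energy and weak solutions *)

Section Energy.
Set Implicit Arguments. Unset Strict Implicit.
Context {R : realType} {N : nat}.
Context (lam : {sigma_finite_measure set (N.-tuple R) -> \bar R}).
Implicit Types (x y : N.-tuple R) (u v w f : N.-tuple R -> R).

(** The exceptional pairs lie in two cylinders over a null set, null for the product measure because
    [0 * +oo = 0]. *)
Lemma ae_fst_snd (P : N.-tuple R -> Prop) : {ae lam, forall x, P x} ->
  {ae (lam \x lam)%E, forall z : N.-tuple R * N.-tuple R, P z.1 /\ P z.2}.
Proof.
move=> [Z [mZ Z0 PZ]].
have h1 : {ae (lam \x lam)%E, forall z : N.-tuple R * N.-tuple R, P z.1}.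
  exists (Z `*` setT); split; first exact: measurableX.
    by transitivity (lam Z * lam setT)%E; [exact: product_measure1E|rewrite Z0 mul0e].
  by move=> [x y] /= nP; split => //; exact: PZ.
have h2 : {ae (lam \x lam)%E, forall z : N.-tuple R * N.-tuple R, P z.2}.
  exists (setT `*` Z); split; first exact: measurableX.
    by transitivity (lam setT * lam Z)%E; [exact: product_measure1E|rewrite Z0 mule0].
  by move=> [x y] /= nP; split => //; exact: PZ.
by apply: filterS2 h1 h2 => z.
Qed.

(** The same conditional as in [LpnormOn], so that the norms unfold to integrals of [zero_off] over
    the whole space. *)
Definition zero_off (Om : set (N.-tuple R)) (g : N.-tuple R -> R) x : R :=
  if x \in Om then g x else 0.

Lemma zero_off_in Om g x : Om x -> zero_off Om g x = g x.
Proof. by move=> Ox; rewrite /zero_off mem_set. Qed.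

Lemma zero_off_out Om g x : ~ Om x -> zero_off Om g x = 0.
Proof. by move=> Ox; rewrite /zero_off memNset. Qed.

Lemma zero_off_id Om g : (forall x, ~ Om x -> g x = 0) -> zero_off Om g = g.
Proof.
move=> g0; apply/funext => x; have [Ox|Ox] := pselect (Om x).
  by rewrite zero_off_in.
by rewrite zero_off_out// g0.
Qed.

Context (Om : set (N.-tuple R)).
Hypothesis mOm : measurable Om.

Lemma measurable_zero_off g : measurable_fun Om g -> measurable_fun setT (zero_off Om g).
Proof.
move=> mg.
have OmE : (fun x => x \in Om) @^-1` [set true] = Om.
  by apply/seteqP; split=> x /=; [exact: set_mem|exact: mem_set].
apply: (measurable_fun_if measurableT).
- by apply: (measurable_fun_bool true); rewrite setTI OmE.
- by rewrite OmE setTI.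
- exact: measurable_cst.
Qed.

Lemma integral_zero_off_mul f v : (forall x, ~ Om x -> v x = 0) ->
  measurable_fun Om f -> measurable_fun setT v ->
  (\int[lam]_(x in Om) (f x * v x)%:E <= \int[lam]_x (`|zero_off Om f x| * `|v x|)%:E)%E.
Proof.
move=> v0 mf mv; rewrite integral_mkcond; apply: le_trans (lee_abs _) _.
apply: le_trans (le_abse_integral _ _ _) _ => //.
  apply/(measurable_restrictT _ mOm); apply/measurable_EFinP.
  by apply: measurable_funM => //; exact: measurable_funS mv.
rewrite le_eqVlt; apply/orP; left; apply/eqP; apply: eq_integral => x _.
rewrite patchE -normrM; case: ifPn => xO; first by rewrite /zero_off xO.
by rewrite v0 ?mulr0 ?normr0 ?abse0//; move: xO; rewrite notin_setE.
Qed.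

Lemma measurable_QOmega : measurable (QOmega Om).
Proof.
have -> : QOmega Om = (Om `*` setT) `|` (setT `*` Om).
  by apply/seteqP; split=> [[x y] /= [?|?]|[x y] /= [[]|[]]]; rewrite /QOmega/=; tauto.
by apply: measurableU; exact: measurableX.
Qed.

Context (J : N.-tuple R -> N.-tuple R -> R).
Hypothesis mJ : measurable_fun setT (fun z : N.-tuple R * N.-tuple R => J z.1 z.2).
Hypothesis J0 : forall x y, 0 <= J x y.

Lemma measurable_energy u v : measurable_fun setT u -> measurable_fun setT v ->
  measurable_fun setT (fun z : N.-tuple R * N.-tuple R =>
    (u z.1 - u z.2) * (v z.1 - v z.2) * J z.1 z.2).
Proof. by move=> mu mv; apply: measurable_funM => //; meas. Qed.

Lemma energy_ae_eq u u' v v' :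
  measurable_fun setT u -> measurable_fun setT u' ->
  measurable_fun setT v -> measurable_fun setT v' ->
  {ae lam, forall x, u x = u' x} -> {ae lam, forall x, v x = v' x} ->
  energy lam J Om u v = energy lam J Om u' v'.
Proof.
move=> mu mu' mv mv' uu' vv'; rewrite /energy; congr (_ * _)%E.
apply: ae_eq_integral => //; first exact: measurable_QOmega.
- by apply: measurable_funTS; apply/measurable_EFinP; exact: measurable_energy.
- by apply: measurable_funTS; apply/measurable_EFinP; exact: measurable_energy.
apply: filterS2 (ae_fst_snd uu') (ae_fst_snd vv') => z [u1 u2] [v1 v2] _.
by rewrite u1 u2 v1 v2.
Qed.

(** As [P] vanishes off [QOmega], its integral over the whole product can be compared with the
    energy, and Tonelli's theorem makes it an iterated integral. *)
Lemma energy_ge u v (P : N.-tuple R * N.-tuple R -> R) :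
  measurable_fun setT u -> measurable_fun setT v -> measurable_fun setT P ->
  (forall z, 0 <= P z) -> (forall z, ~ QOmega Om z -> P z = 0) ->
  (forall z, 0 <= (u z.1 - u z.2) * (v z.1 - v z.2)) ->
  (forall z, P z <= (u z.1 - u z.2) * (v z.1 - v z.2) * J z.1 z.2) ->
  ((2^-1)%:E * \int[lam]_x \int[lam]_y (P (x, y))%:E <= energy lam J Om u v)%E.
Proof.
move=> mu mv mP P0 PQ uv0 PJ; rewrite /energy lee_wpmul2l ?lee_fin//.
rewrite -(fubini_tonelli1 (fun z => (P z)%:E)) /fubini_F; first last.
- by move=> z; rewrite lee_fin.
- exact/measurable_EFinP.
rewrite [leRHS]integral_mkcond; apply: ge0_le_integral => //.
- by move=> z _; rewrite lee_fin.
- exact/measurable_EFinP.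
- apply/(measurable_restrictT _ measurable_QOmega); apply: measurable_funTS.
  by apply/measurable_EFinP; exact: measurable_energy.
move=> z _; rewrite patchE; case: ifPn => zQ; first by rewrite lee_fin.
by rewrite PQ//; move: zQ; rewrite notin_setE.
Qed.

Lemma LpnormOn_powR p g : 0 < p ->
  (LpnormOn lam Om p%:E g `^ p = \int[lam]_x (`|zero_off Om g x| `^ p)%:E)%E.
Proof. by move=> p0; rewrite /LpnormOn poweR_Lnorm ?gt_eqF. Qed.

Lemma LpnormOn_le p g (B : R) : 0 < p -> 0 <= B ->
  (\int[lam]_x (`|zero_off Om g x| `^ p)%:E <= (B `^ p)%:E)%E ->
  (LpnormOn lam Om p%:E g <= B%:E)%E.
Proof.
move=> p0 B0 h; rewrite /LpnormOn unlock.
have -> : B%:E = ((B `^ p)%:E `^ p^-1)%E.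
  by rewrite poweR_EFin -powRrM mulfV ?gt_eqF// powRr1.
apply: gt0_ler_poweR => //.
- by rewrite invr_ge0 ltW.
- by rewrite in_itv/= leey andbT; apply: integral_ge0 => x _; rewrite lee_fin powR_ge0.
- by rewrite in_itv/= leey andbT lee_fin powR_ge0.
Qed.

Lemma integral_le_LpnormOn p g (B : R) : 0 < p -> 0 <= B ->
  (LpnormOn lam Om p%:E g <= B%:E)%E ->
  (\int[lam]_x (`|zero_off Om g x| `^ p)%:E <= (B `^ p)%:E)%E.
Proof.
move=> p0 B0 h; rewrite -LpnormOn_powR//.
rewrite -poweR_EFin; apply: gt0_ler_poweR => //; first exact: ltW.
- by rewrite in_itv/= leey andbT; exact: Lnorm_ge0.
- by rewrite in_itv/= leey andbT lee_fin.
Qed.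

Lemma L2normOn_fin g :
  (LpnormOn lam Om 2%:E g < +oo)%E <-> (\int[lam]_x (zero_off Om g x ^+ 2)%:E < +oo)%E.
Proof.
have E : (\int[lam]_x (zero_off Om g x ^+ 2)%:E =
    \int[lam]_x (`|zero_off Om g x| `^ 2)%:E)%E.
  by apply: eq_integral => x _; rewrite powR_mulrn// real_normK// num_real.
rewrite E; split=> h.
  by rewrite -LpnormOn_powR//; exact: poweR_lty.
by rewrite /LpnormOn unlock; apply: poweR_lty.
Qed.

Lemma HJ0_zero_offP w : (forall x, ~ Om x -> w x = 0) ->
  HJ0 lam J Om w <-> [/\ measurable_fun setT w, (\int[lam]_x (w x ^+ 2)%:E < +oo)%E &
    (energy lam J Om w w < +oo)%E].
Proof.
move=> w0; have E := zero_off_id w0; split.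
  by case=> mw /L2normOn_fin; rewrite E.
case=> mw w2 Ew; split=> //; first by apply/L2normOn_fin; rewrite E.
exact: aeW.
Qed.

(** The increment bound controls the energy and, with [b = 0], the square integral. This makes
    truncations of the solution admissible test functions. *)
Lemma HJ0_lip w (G : R -> R) (c : R) : (forall x, ~ Om x -> w x = 0) ->
  measurable_fun setT G -> G 0 = 0 ->
  (forall a b, (G a - G b) ^+ 2 <= c * (a - b) ^+ 2) -> 0 <= c ->
  HJ0 lam J Om w -> HJ0 lam J Om (G \o w).
Proof.
move=> w0 mG G0 Gl c0 /(HJ0_zero_offP w0) [mw w2 Ew].
have mGw : measurable_fun setT (G \o w) by exact: measurableT_comp.
apply/HJ0_zero_offP => [x Ox|]; first by rewrite /= w0.
split=> //.
  apply: (@le_lt_trans _ _ (c%:E * \int[lam]_x (w x ^+ 2)%:E)%E); last first.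
    by apply: lte_mul_pinfty; rewrite ?lee_fin.
  rewrite -nneg_integralZ//; [|by meas|by move=> x; exact: sqr_ge0].
  apply: nneg_le_integral => //; [by meas|by meas|by move=> x _; exact: sqr_ge0|].
  by move=> x _; have := Gl (w x) 0; rewrite G0 !subr0.
pose F w z := ((w z.1 - w z.2) * (w z.1 - w z.2) * J z.1 z.2 : R).
have F0 v z : 0 <= F v z by rewrite /F -expr2 mulr_ge0// sqr_ge0.
have mF v : measurable_fun setT v -> measurable_fun setT (F v).
  by move=> mv; exact: measurable_energy.
have mF1 := measurable_funTS (D := QOmega Om) (mF _ mw).
have mF2 := measurable_funTS (D := QOmega Om) (mF _ mGw).
have I0 v : (0 <= \int[(lam \x lam)%E]_(z in QOmega Om) (F v z)%:E)%E.
  by apply: integral_ge0 => z _; rewrite lee_fin.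
have {}Ew : (\int[(lam \x lam)%E]_(z in QOmega Om) (F w z)%:E < +oo)%E.
  move: Ew; rewrite /energy -/(F w); rewrite ltey => Ew; rewrite ltey.
  by apply: contra Ew => /eqP ->; rewrite gt0_muley// lte_fin.
rewrite /energy; apply: lte_mul_pinfty; rewrite ?lee_fin//.
apply: (@le_lt_trans _ _ (c%:E * \int[(lam \x lam)%E]_(z in QOmega Om) (F w z)%:E)%E); last first.
  by apply: lte_mul_pinfty; rewrite ?lee_fin.
rewrite -ge0_integralZl//; [|exact: measurable_QOmega|exact/measurable_EFinP|
  by move=> z _; rewrite lee_fin].
apply: ge0_le_integral; first exact: measurable_QOmega.
- by move=> z _; rewrite lee_fin; exact: (F0 (G \o w)).
- exact/measurable_EFinP.
- by apply: emeasurable_funM => //; exact/measurable_EFinP.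
move=> z _; rewrite -EFinM lee_fin /F mulrA -!expr2; apply: ler_wpM2r => //; exact: Gl.
Qed.

(** Changing [u] on a null set alters neither the energy nor membership in the space, so the
    exterior condition may be assumed at every point. *)
Lemma weak_solution_zero_off f u : weak_solution lam J Om f u ->
  weak_solution lam J Om f (zero_off Om u).
Proof.
move=> [[mu u2 Eu u0] Hu].
have mw : measurable_fun setT (zero_off Om u).
  by apply: measurable_zero_off; exact: measurable_funTS.
have uw : {ae lam, forall x, u x = zero_off Om u x}.
  apply: filterS u0 => x h; have [Ox|Ox] := pselect (Om x).
    by rewrite zero_off_in.
  by rewrite zero_off_out// h.
split; last first.
  move=> phi hphi; rewrite -Hu//; have [mphi _ _ _] := hphi.
  by apply: energy_ae_eq => //; [apply: filterS uw => x ->|exact: aeW].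
apply/HJ0_zero_offP; first by move=> x; exact: zero_off_out.
split=> //; first exact/L2normOn_fin.
by rewrite -(energy_ae_eq mu mw mu mw uw uw).
Qed.

End Energy.

(** * Testing the equation with the solution and with its truncations *)

Section TruncationEstimates.
Set Implicit Arguments. Unset Strict Implicit.
Context {R : realType} {N : nat}.
Context (lam : {sigma_finite_measure set (N.-tuple R) -> \bar R}).
Hypothesis Hlam : is_lebesgue_measure lam.
Context (Om : set (N.-tuple R)).
Hypothesis mOm : measurable Om.
Context (J : N.-tuple R -> N.-tuple R -> R).
Hypothesis mJ : measurable_fun setT (fun z : N.-tuple R * N.-tuple R => J z.1 z.2).
Hypothesis J0 : forall x y, 0 <= J x y.
Context (k : N.-tuple R -> R) (n : nat).
Hypothesis mk : measurable_fun setT k.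
Hypothesis k0n : forall z, 0 <= k z <= n%:R.
Hypothesis k3 : (3%:E <= \int[lam]_z (k z)%:E)%E.
Hypothesis kJ : forall x y, k (vsub y x) <= J x y.
Implicit Types (x y : N.-tuple R) (w f : N.-tuple R -> R).

Let k0 z : 0 <= k z. Proof. by have /andP[] := k0n z. Qed.

Context (f w : N.-tuple R -> R).
Hypothesis mf : measurable_fun Om f.
Hypothesis w0 : forall x, ~ Om x -> w x = 0.
Hypothesis wf : weak_solution lam J Om f w.

Let mw : measurable_fun setT w. Proof. by have [[]] := wf. Qed.

Let mf0 : measurable_fun setT (zero_off Om f).
Proof. exact: measurable_zero_off. Qed.

Lemma weak_solution_test phi : (forall x, ~ Om x -> phi x = 0) -> HJ0 lam J Om phi ->
  (energy lam J Om w phi <= \int[lam]_x (`|zero_off Om f x| * `|phi x|)%:E)%E.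
Proof.
move=> phi0 Hphi; have [_ ->//] := wf; have [mphi _ _ _] := Hphi.
exact: integral_zero_off_mul.
Qed.

(** Testing with [w] itself and using [k <= J], the Poincare inequality with mass [3] gives
    [3 I <= 2 C \int |f| |w| <= I + C^2 F2], and [I] is absorbed on the left. *)
Lemma weak_solution_L2 (C : R) : 0 < C ->
  (\int[lam]_x (w x ^+ 2)%:E * \int[lam]_z (k z)%:E <=
     C%:E * \int[lam]_x \int[lam]_y ((w x - w y) ^+ 2 * k (vsub y x))%:E)%E ->
  (\int[lam]_x (w x ^+ 2)%:E <=
   (C ^+ 2)%:E * \int[lam]_x (zero_off Om f x ^+ 2)%:E)%E.
Proof.
move=> C0 poin.
have [Hw _] := wf; have [_ w2 _] := (HJ0_zero_offP lam J w0).1 Hw.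
set I := integral _ _ _ in w2 poin *; set F2 := integral _ _ _.
have I0 : (0 <= I)%E by apply: integral_ge0 => x _; rewrite lee_fin sqr_ge0.
have F20 : (0 <= F2)%E by apply: integral_ge0 => x _; rewrite lee_fin sqr_ge0.
have En : ((2^-1)%:E * \int[lam]_x \int[lam]_y ((w x - w y) ^+ 2 * k (vsub y x))%:E
    <= \int[lam]_x (`|zero_off Om f x| * `|w x|)%:E)%E.
  apply: le_trans (weak_solution_test w0 Hw).
  apply: (energy_ge lam mOm mJ mw mw (P := fun z => (w z.1 - w z.2) ^+ 2 * k (vsub z.2 z.1))).
  - by meas.
  - by move=> z; rewrite mulr_ge0// sqr_ge0.
  - move=> [x y]; rewrite /QOmega/= => /not_orP[Ox Oy].
    by rewrite !w0// subrr expr0n mul0r.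
  - by move=> z; rewrite -expr2 sqr_ge0.
  - by move=> z; rewrite -expr2 ler_wpM2l// sqr_ge0.
(* AM-GM: [2 C |f| |w| <= w^2 + C^2 f^2] *)
have Yo : ((2 * C)%:E * \int[lam]_x (`|zero_off Om f x| * `|w x|)%:E <=
    I + (C ^+ 2)%:E * F2)%E.
  rewrite -nneg_integralZ; [|by meas|by move=> x; rewrite mulr_ge0|lra].
  rewrite /F2 -nneg_integralZ; [|by meas|by move=> x; exact: sqr_ge0|exact: sqr_ge0].
  rewrite -nneg_integralD; [|by meas|by meas|by move=> x; exact: sqr_ge0|
     by move=> x; rewrite mulr_ge0 ?sqr_ge0].
  apply: nneg_le_integral => //; [by meas|by meas|by move=> x _; rewrite !mulr_ge0// ltW|].
  move=> x _; have := sqr_ge0 (C * `|zero_off Om f x| - `|w x|).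
  rewrite sqrrB exprMn !real_normK ?num_real//.
  by rewrite -mulr_natl => h; lra.
have : (3%:E * I <= I + (C ^+ 2)%:E * F2)%E.
  apply: le_trans Yo.
  apply: (@le_trans _ _ (I * \int[lam]_z (k z)%:E)%E).
    by rewrite muleC lee_wpmul2l.
  apply: le_trans poin _; rewrite mulrC EFinM -muleA; apply: lee_wpmul2l.
    by rewrite lee_fin ltW.
  by rewrite -lee_pdivrMl// .
(* Absorption requires [I] finite, which is part of membership in the energy space; [F2] may be
   infinite. *)
move: I F2 I0 F20 w2 {poin Yo}; case=> [a| |]//; case=> [b| |]// a0 b0 _; last first.
  by rewrite mulry gtr0_sg ?mul1e ?leey// exprn_gt0.
by move: a0; rewrite -!EFinM -EFinD !lee_fin; lra.
Qed.

(** The mass [2] that [k] keeps off [A] exactly offsets the factor [1/2] of the energy, hence the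
    constant [1]. The Lipschitz constant [L] only secures admissibility of the test function and is
    absent from the bound. *)
Lemma weak_solution_truncation (h : R -> R) (t L : R) : 0 <= t ->
  {homo h : a b / a <= b} -> (forall s, s <= t -> h s = 0) ->
  (forall a b, `|h a - h b| <= L * `|a - b|) ->
  (n%:R%:E * lam [set x | (t < `|w x|)%R] <= 1)%E ->
  (\int[lam]_x (Num.max (`|w x| - t) 0 * h `|w x|)%:E <=
   \int[lam]_x (`|zero_off Om f x| * h `|w x|)%:E)%E.
Proof.
move=> t0 hnd ht hlip; set A := [set x | _] => nA.
have mh : measurable_fun setT h by exact: nondecreasing_measurable.
have mG : measurable_fun setT (odd_ext h) by apply: measurable_funB; meas.
have h0 := profile_ge0 hnd ht.
have mA : measurable A by exact: measurable_norm_gt.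
have [Hw _] := wf.
have phi0 x : ~ Om x -> (odd_ext h \o w) x = 0.
  by move=> Ox; rewrite /= w0// (odd_ext0 t0 hnd ht)// normr0.
have Hphi : HJ0 lam J Om (odd_ext h \o w).
  apply: (HJ0_lip mOm mJ J0 (c := (2 * L) ^+ 2)) => //.
  - by rewrite (odd_ext0 t0 hnd ht)// normr0.
  - exact: odd_ext_sqr_lip.
  - exact: sqr_ge0.
have := weak_solution_test phi0 Hphi.
under [X in (_ <= X)%E]eq_integral do rewrite /= (odd_ext_norm t0 hnd ht).
apply: le_trans.
(* Only the pairs [(x, y)] with [x] in [A] and [y] off [A] are kept in the energy. *)
pose Phi x := Num.max (`|w x| - t) 0 * h `|w x|.
pose P (z : N.-tuple R * N.-tuple R) := Phi z.1 * (\1_(~` A) z.2 * k (vsub z.2 z.1)).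
have m1 : measurable_fun setT (\1_(~` A) : _ -> R).
  by apply: measurable_indic; exact: measurableC.
have i0 y : 0 <= \1_(~` A) y :> R by rewrite indicE.
have mPhi : measurable_fun setT Phi by rewrite /Phi; meas.
have Phi0 x : 0 <= Phi x by rewrite mulr_ge0// le_max lexx orbT.
have mP : measurable_fun setT P by rewrite /P; meas.
have P0 z : 0 <= P z by apply: mulr_ge0 => //; exact: mulr_ge0.
have := energy_ge (u := w) (v := odd_ext h \o w) lam mOm mJ mw (measurableT_comp mG mw) mP P0.
move=> EP; apply: le_trans (EP _ _ _).
- rewrite -[X in (X <= _)%E]/(\int[lam]_x (Phi x)%:E)%E.
  rewrite lee_pdivlMl// -nneg_integralZ//.
  apply: ge0_le_integral => //.
  + by move=> x _; rewrite lee_fin mulr_ge0.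
  + by meas.
  + apply: (@measurable_fun_fubini_tonelli_F _ _ _ _ _ lam (EFin \o P)).
      exact/measurable_EFinP.
    by move=> z; rewrite lee_fin.
  move=> x _.
  rewrite -[leRHS]/(\int[lam]_y (Phi x * (\1_(~` A) y * k (vsub y x)))%:E)%E.
  rewrite nneg_integralZ//; [|by meas|by move=> y; rewrite mulr_ge0].
  rewrite EFinM muleC; apply: lee_wpmul2l; first by rewrite lee_fin.
  exact: (kernel_mass_off_small_set Hlam x mk k0n k3 mA nA).
- move=> [x y]; rewrite /QOmega/= => /not_orP[Ox Oy].
  by rewrite /P /Phi/= w0// normr0 (ht 0)// mulr0 mul0r.
- by move=> z; exact: odd_ext_monotone hnd _ _.
(* For [y] in [A], [P] vanishes and monotonicity suffices; for [y] off [A], [|w y| <= t] and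
   [odd_ext_gap] applies, together with [k <= J]. *)
- move=> [x y]; rewrite /P /= indicE; have [yA|yA] := boolP (y \in ~` A); last first.
    by rewrite mul0r mulr0 mulr_ge0//; exact: odd_ext_monotone hnd _ _.
  rewrite mul1r; apply: ler_pM => //.
  apply: odd_ext_gap => //; move: yA; rewrite inE /A /= => /negP.
  by rewrite -leNgt.
Qed.

End TruncationEstimates.

(** * Bounds in [L^p] *)

Section PowerTruncation.
Set Implicit Arguments. Unset Strict Implicit.
Context {R : realType}.
Implicit Types (a b p q s t M : R).

Lemma powR_sub1 a q : 1 <= q -> 0 <= a -> a * a `^ (q - 1) = a `^ q.
Proof.
move=> q1 a0; have [->|q1'] := eqVneq q 1.
  by rewrite subrr powRr0 mulr1 powRr1.
rewrite -{1}[a]powRr1// -powRD; last by rewrite addrC subrK gt_eqF// (lt_le_trans _ q1).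
by congr powR; lra.
Qed.

(** Young's inequality with exponents [q] and [q / (q - 1)], multiplied by [q]. The case [q = 1],
    without finite conjugate exponent, is an equality. *)
Lemma powR_young a b q : 1 <= q -> 0 <= a -> 0 <= b ->
  q * (b * a `^ (q - 1)) <= b `^ q + (q - 1) * a `^ q.
Proof.
move=> q1 a0 b0; have [->|qN1] := eqVneq q 1.
  by rewrite subrr powRr0 mulr1 mul1r mul0r addr0 powRr1.
have q1' : 1 < q by rewrite lt_neqAle eq_sym qN1.
have q0 : 0 < q by lra.
have q10 : 0 < q - 1 by lra.
have := @conjugate_powR R b (a `^ (q - 1)) q (q / (q - 1)) b0 (powR_ge0 _ _) q0.
rewrite -powRrM (mulrC (q - 1)) divfK ?gt_eqF// => /(_ (divr_gt0 q0 q10)).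
have e : q^-1 + (q / (q - 1))^-1 = 1 by field; rewrite !gt_eqF.
move=> /(_ e) /(ler_wpM2l (ltW q0)) /le_trans; apply.
rewrite le_eqVlt; apply/orP; left; apply/eqP; field; rewrite !gt_eqF//.
Qed.

(** For [b <= a], [powR_young] rearranges to the tangent bound [a^q - b^q <= q a^(q-1) (a - b)], in
    place of the mean value theorem. *)
Lemma powR_lipschitz M a b q : 1 <= q -> 0 <= a <= M -> 0 <= b <= M ->
  `|a `^ q - b `^ q| <= q * M `^ (q - 1) * `|a - b|.
Proof.
move=> q1.
wlog ba : a b / b <= a => [hw aM bM|].
  have [/hw|/ltW /hw h] := leP b a; first exact.
  by rewrite distrC [`|a - b|]distrC h.
move=> /andP[a0 aM] /andP[b0 bM].
have q0 : 0 <= q by lra.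
rewrite !ger0_norm ?subr_ge0//; last by rewrite ge0_ler_powR// nnegrE.
apply: (@le_trans _ _ (q * a `^ (q - 1) * (a - b))); last first.
  apply: ler_wpM2r; first by rewrite subr_ge0.
  apply: ler_wpM2l => //; apply: ge0_ler_powR; rewrite ?nnegrE//; first lra.
  exact: le_trans a0 aM.
have := powR_young q1 a0 b0; have := powR_sub1 q1 a0.
set A := a `^ (q - 1); set B := b `^ q; set D := a `^ q => e h.
have -> : q * A * (a - b) = q * (a * A) - q * (b * A) by ring.
by rewrite e; lra.
Qed.

(** The cut at height [M] makes the profile globally Lipschitz, as [p - 1 >= 1] when [p >= 2]; it
    also makes the integrals finite before [M] tends to infinity. *)
Definition power_trunc t M p s : R := Num.min (Num.max (s - t) 0) M `^ (p - 1).

Lemma trunc_bounds t M s : 0 <= M -> 0 <= Num.min (Num.max (s - t) 0) M <= M.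
Proof. by move=> M0; rewrite le_min le_max lexx orbT M0 ge_min lexx orbT. Qed.

Lemma power_trunc_nd t M p : 0 <= M -> 2 <= p ->
  {homo power_trunc t M p : a b / a <= b}.
Proof.
move=> M0 p2 a b ab; rewrite /power_trunc.
apply: ge0_ler_powR; first lra.
- by rewrite nnegrE; have /andP[] := trunc_bounds t a M0.
- by rewrite nnegrE; have /andP[] := trunc_bounds t b M0.
by apply: le_min2 => //; apply: le_max2 => //; rewrite lerB.
Qed.

Lemma power_trunc0 t M p s : 0 <= M -> 2 <= p -> s <= t -> power_trunc t M p s = 0.
Proof.
move=> M0 p2 st; rewrite /power_trunc max_r ?subr_le0// min_l// powR0//.
by rewrite gt_eqF//; lra.
Qed.

Lemma trunc_lip t M a b :
  `|Num.min (Num.max (a - t) 0) M - Num.min (Num.max (b - t) 0) M| <= `|a - b|.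
Proof.
wlog ba : a b / b <= a => [hw|].
  have [/hw//|/ltW /hw h] := leP b a.
  by rewrite distrC [`|a - b|]distrC.
rewrite !ger0_norm ?subr_ge0//; last first.
  by apply: le_min2 => //; apply: le_max2 => //; rewrite lerB.
rewrite lerBlDr; rewrite /Num.max /Num.min.
by repeat case: ifPn; rewrite ?ltNge ?negbK; lra.
Qed.

Lemma power_trunc_lip t M p a b : 0 <= M -> 2 <= p ->
  `|power_trunc t M p a - power_trunc t M p b| <=
  (p - 1) * M `^ (p - 1 - 1) * `|a - b|.
Proof.
move=> M0 p2; have p1 : 1 <= p - 1 by lra.
apply: le_trans (powR_lipschitz p1 (trunc_bounds t a M0) (trunc_bounds t b M0)) _.
apply: ler_wpM2l; first by rewrite mulr_ge0 ?powR_ge0//; lra.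
exact: trunc_lip.
Qed.

End PowerTruncation.

Section MonotoneTruncation.
Set Implicit Arguments. Unset Strict Implicit.

(** Monotone convergence: at each point the truncations increase and are eventually equal to
    [v x]. *)
Lemma integral_powR_le_trunc d (T : measurableType d) (R : realType)
    (mu : {measure set T -> \bar R}) (v : T -> R) (p : R) (c : \bar R) :
  0 <= p -> measurable_fun setT v -> (forall x, 0 <= v x) ->
  (forall m : nat, \int[mu]_x (Num.min (v x) m%:R `^ p)%:E <= c)%E ->
  (\int[mu]_x (v x `^ p)%:E <= c)%E.
Proof.
move=> p0 mv v0 hc.
pose g (m : nat) x := (Num.min (v x) m%:R `^ p)%:E.
have mg m : measurable_fun setT (g m) by rewrite /g; meas.
have g0 m x : setT x -> (0 <= g m x)%E by rewrite lee_fin powR_ge0.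
have ndg x : setT x -> nondecreasing_seq (g ^~ x).
  move=> _ m m' mm'; rewrite lee_fin; apply: ge0_ler_powR => //.
  - by rewrite nnegrE le_min v0 ler0n.
  - by rewrite nnegrE le_min v0 ler0n.
  by apply: le_min2 => //; rewrite ler_nat.
have -> : (\int[mu]_x (v x `^ p)%:E = \int[mu]_x limn (g ^~ x))%E.
  apply: eq_integral => x _; apply/esym/cvg_lim => //.
  apply: cvg_near_cst; exists (Num.truncn (v x)).+1 => // m /= xm.
  rewrite /g min_l// ltW// (lt_le_trans (truncnS_gt _))// ler_nat.
  exact: xm.
rewrite monotone_convergence//; apply: lime_le; last exact: nearW.
by apply: ereal_nondecreasing_is_cvgn => m m' mm'; apply: ge0_le_integral => // x Tx;
  [exact: g0|exact: ndg].
Qed.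

End MonotoneTruncation.

(** * From the truncation inequality to norm bounds *)

Section LpBounds.
Set Implicit Arguments. Unset Strict Implicit.
Context {R : realType} {N : nat}.
Context (lam : {sigma_finite_measure set (N.-tuple R) -> \bar R}).
Context (Om : set (N.-tuple R)).
Hypothesis mOm : measurable Om.
Hypothesis Om_fin : (lam Om < +oo)%E.
Implicit Types (x : N.-tuple R) (f g w : N.-tuple R -> R).

Lemma Om_measure_fineK : (fine (lam Om))%:E = lam Om.
Proof. by rewrite fineK// ge0_fin_numE. Qed.

Lemma integral_scaled_indic (c : R) : 0 <= c ->
  (\int[lam]_x (c * \1_Om x)%:E = (c * fine (lam Om))%:E)%E.
Proof.
move=> c0; rewrite nneg_integralZ//.
by rewrite integral_indic// setIT EFinM Om_measure_fineK.
Qed.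

Lemma LpnormOn_infty_le g (B : R) : 0 <= B ->
  {ae lam, forall x, `|zero_off Om g x| <= B} -> (LpnormOn lam Om +oo g <= B%:E)%E.
Proof.
move=> B0 h; rewrite /LpnormOn unlock; case: ifPn => _; last by rewrite lee_fin.
by apply/ess_supP; apply: filterS h => x /=; rewrite lee_fin.
Qed.

Lemma ae_le_LpnormOn_infty g (B : R) : (LpnormOn lam Om +oo g <= B%:E)%E ->
  {ae lam, forall x, `|zero_off Om g x| <= B}.
Proof.
rewrite /LpnormOn unlock; case: ifPn => [_ /ess_supP|l0 _].
  by apply: filterS => x /=; rewrite lee_fin.
(* When the whole space has measure zero, the sup norm is [0] by convention and any property holds
   almost everywhere. *)
exists setT; split => //; apply/eqP; rewrite eq_le measure_ge0 andbT.
by move: l0; rewrite -leNgt.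
Qed.

(** The factor [lam Om + 1] serves all [p] in [[2, +oo]] at once, which keeps later constants free
    of [p]. *)
Lemma LpnormOn_L2 (p : \bar R) f (B : R) : (2%:E <= p)%E -> 0 < B ->
  measurable_fun Om f -> (LpnormOn lam Om p f <= B%:E)%E ->
  (\int[lam]_x (zero_off Om f x ^+ 2)%:E <= (B ^+ 2 * (fine (lam Om) + 1))%:E)%E.
Proof.
move=> p2 B0 mf; have mf0 := measurable_zero_off mOm mf.
have V0 : 0 <= fine (lam Om) by rewrite fine_ge0.
have m1 : measurable_fun setT (\1_Om : _ -> R) by exact: measurable_indic.
have i0 x : 0 <= \1_Om x :> R by rewrite indicE.
have B2 : 0 <= B ^+ 2 by exact: sqr_ge0.
case: p p2 => [p| |]//; last first.
  move=> _ /ae_le_LpnormOn_infty fB.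
  apply: (@le_trans _ _ (\int[lam]_x (B ^+ 2 * \1_Om x)%:E)%E); last first.
    by rewrite integral_scaled_indic// lee_fin ler_wpM2l// lerDl.
  apply: ae_ge0_le_integral => //.
  - by move=> x _; rewrite lee_fin sqr_ge0.
  - by meas.
  - by move=> x _; rewrite lee_fin mulr_ge0.
  - by meas.
  apply: filterS fB => x h _; rewrite lee_fin indicE.
  have [xO|xO] := boolP (x \in Om).
    by rewrite mulr1 -real_normK ?num_real// lerXn2r ?nnegrE// ltW.
  by rewrite mulr0 /zero_off (negbTE xO) expr0n.
rewrite lee_fin => p2 fB.
have p0 : 0 < p by lra.
have fp := integral_le_LpnormOn p0 (ltW B0) fB.
have Bp : 0 < B `^ p by exact: powR_gt0.
(* [(f / B)^2 <= 1 + (|f| / B)^p], hence no Hoelder inequality is needed. *)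
apply: (@le_trans _ _ (\int[lam]_x (B ^+ 2 * \1_Om x +
    B ^+ 2 / B `^ p * `|zero_off Om f x| `^ p)%:E)%E).
  apply: nneg_le_integral => //; [by meas|by meas|by move=> x _; exact: sqr_ge0|].
  move=> x _; rewrite indicE.
  have [xO|xO] := boolP (x \in Om); last first.
    rewrite /zero_off (negbTE xO) expr0n/= normr0 powR0 ?mulr0 ?addr0//.
    by rewrite gt_eqF.
  rewrite mulr1 -real_normK ?num_real//.
  have := normr_ge0 (zero_off Om f x); set a := `|zero_off Om f x| => a0.
  have e0 : 0 <= B ^+ 2 / B `^ p * a `^ p.
    by rewrite mulr_ge0 ?powR_ge0// divr_ge0// ltW.
  have [aB|Ba] := leP a B.
    by apply: (@le_trans _ _ (B ^+ 2)); [rewrite lerXn2r ?nnegrE// ltW|rewrite lerDl].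
  apply: (@le_trans _ _ (B ^+ 2 / B `^ p * a `^ p)); last by rewrite lerDr.
  have -> : B ^+ 2 / B `^ p * a `^ p = B ^+ 2 * (a / B) `^ p.
    have -> : a `^ p = (a / B) `^ p * B `^ p.
      by rewrite -powRM ?divfK ?gt_eqF// ?divr_ge0// ltW.
    by field; rewrite gt_eqF.
  have -> : a ^+ 2 = B ^+ 2 * (a / B) ^+ 2 by field; rewrite gt_eqF.
  have aB0 : 0 <= a / B by rewrite divr_ge0// ltW.
  apply: ler_wpM2l => //; rewrite -(powR_mulrn 2 aB0).
  by apply: ler_powR => //; rewrite ler_pdivlMr// mul1r ltW.
rewrite nneg_integralD; [|by meas|by meas|by move=> x; rewrite mulr_ge0|
  by move=> x; rewrite mulr_ge0 ?powR_ge0// divr_ge0// ltW].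
rewrite integral_scaled_indic// nneg_integralZ; [|by meas|by move=> x; exact: powR_ge0|
  by rewrite divr_ge0// ltW].
rewrite mulrDr mulr1 EFinD; apply: leeD => //.
apply: (@le_trans _ _ ((B ^+ 2 / B `^ p)%:E * (B `^ p)%:E)%E).
  by apply: lee_wpmul2l => //; rewrite lee_fin divr_ge0// ltW.
by rewrite -EFinM lee_fin divfK// gt_eqF.
Qed.

(** * Consequences of the truncation inequality at a fixed level [t] *)

Context (f w : N.-tuple R -> R) (t : R).
Hypothesis mf : measurable_fun Om f.
Hypothesis mw : measurable_fun setT w.
Hypothesis w0 : forall x, ~ Om x -> w x = 0.
Hypothesis t0 : 0 <= t.
Hypothesis trunc : forall (h : R -> R) (L : R),
  {homo h : a b / a <= b} -> (forall s, s <= t -> h s = 0) ->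
  (forall a b, `|h a - h b| <= L * `|a - b|) ->
  (\int[lam]_x (Num.max (`|w x| - t) 0 * h `|w x|)%:E <=
   \int[lam]_x (`|zero_off Om f x| * h `|w x|)%:E)%E.

Let mf0 : measurable_fun setT (zero_off Om f).
Proof. exact: measurable_zero_off. Qed.

Let v x := Num.max (`|w x| - t) 0.

Let mv : measurable_fun setT v. Proof. by rewrite /v; meas. Qed.

Let v0 x : 0 <= v x. Proof. by rewrite le_max lexx orbT. Qed.

Let v_out x : ~ Om x -> v x = 0.
Proof. by move=> Ox; rewrite /v w0// normr0 sub0r max_r// oppr_le0. Qed.

(** With [a = min(v, m)], the truncation inequality gives [\int a^p <= \int |f| a^(p-1)]. Young's
    inequality turns this into [p I <= F + (p - 1) I], so [I <= F] with constant [1] for every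
    [p]. *)
Lemma trunc_powR_le (p B : R) : 2 <= p -> 0 <= B ->
  (\int[lam]_x (`|zero_off Om f x| `^ p)%:E <= (B `^ p)%:E)%E ->
  (\int[lam]_x (v x `^ p)%:E <= (B `^ p)%:E)%E.
Proof.
move=> p2 B0 fB; have p0 : 0 <= p by lra.
apply: integral_powR_le_trunc => // m; apply: le_trans fB.
have M0 : 0 <= m%:R :> R by [].
pose a x := Num.min (v x) m%:R.
have ma : measurable_fun setT a by rewrite /a; meas.
have a0 x : 0 <= a x by rewrite le_min v0 M0.
have p1 : 1 <= p by lra.
have av x : a x <= v x by rewrite ge_min lexx.
have := trunc (power_trunc_nd t M0 p2) (fun s => power_trunc0 M0 p2 (s := s))
  (fun b c => power_trunc_lip t b c M0 p2).
rewrite -[X in (X <= _)%E]/(\int[lam]_x (v x * a x `^ (p - 1))%:E)%E.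
rewrite -[X in (_ <= X)%E]/(\int[lam]_x (`|zero_off Om f x| * a x `^ (p - 1))%:E)%E.
move=> key.
rewrite -[X in (X <= _)%E]/(\int[lam]_x (a x `^ p)%:E)%E.
set I := integral _ _ _; set F := integral _ _ _.
(* Finiteness, required for absorbing [(p - 1) I]: the integrand is at most [m^p] on [Om] and
   vanishes elsewhere. *)
have Ifin : (I < +oo)%E.
  apply: (@le_lt_trans _ _ (\int[lam]_x (m%:R `^ p * \1_Om x)%:E)%E); last first.
    by rewrite integral_scaled_indic ?ltry// powR_ge0.
  apply: nneg_le_integral => //; [by meas| |by move=> x _; exact: powR_ge0|].
    by apply: measurable_funM => //; exact: measurable_indic.
  move=> x _; rewrite indicE; have [xO|xO] := boolP (x \in Om).
    by rewrite mulr1; apply: ge0_ler_powR; rewrite ?nnegrE// /a ge_min lexx orbT.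
  rewrite mulr0 /a v_out; last by move: xO; rewrite notin_setE.
  by rewrite min_l// powR0// gt_eqF//; lra.
have I0 : (0 <= I)%E by apply: integral_ge0 => x _; rewrite lee_fin powR_ge0.
have F0 : (0 <= F)%E by apply: integral_ge0 => x _; rewrite lee_fin powR_ge0.
have : (p%:E * I <= F + (p - 1)%:E * I)%E.
  apply: (@le_trans _ _ (p%:E * \int[lam]_x (`|zero_off Om f x| * a x `^ (p - 1))%:E)%E).
    apply: lee_wpmul2l; first by rewrite lee_fin.
    apply: le_trans key; apply: nneg_le_integral => //; [by meas|by meas|
      by move=> x _; exact: powR_ge0|].
    by move=> x _; rewrite -powR_sub1// ler_wpM2r ?powR_ge0.
  rewrite -nneg_integralZ//; [|by meas|by move=> x; rewrite mulr_ge0 ?powR_ge0].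
  rewrite /I -nneg_integralZ//; [|by meas|by move=> x; exact: powR_ge0|lra].
  rewrite /F -nneg_integralD; [|by meas|by meas|by move=> x; exact: powR_ge0|
    by move=> x; rewrite mulr_ge0 ?powR_ge0//; lra].
  apply: nneg_le_integral => //; [by meas|by meas| |].
    by move=> x _; rewrite !mulr_ge0 ?powR_ge0.
  by move=> x _; exact: powR_young.
clear key; clearbody I F; case: I I0 Ifin => [i| |]// i0 _.
case: F F0 => [j| |]// j0; last by move=> _; rewrite leey.
by rewrite -!EFinM -EFinD !lee_fin; lra.
Qed.

(** Where [h(|w|) > 0] one has [v = h(|w|) + B], so [\int (h^2 + B h) <= \int |f| h <= B \int h];
    the last integral being finite, [\int h^2 = 0]. *)
Lemma ae_le_trunc (B : R) : 0 < B -> (\int[lam]_x (w x ^+ 2)%:E < +oo)%E ->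
  {ae lam, forall x, `|zero_off Om f x| <= B} -> {ae lam, forall x, `|w x| <= t + B}.
Proof.
move=> B0 w2 fB.
pose h s := Num.max (s - (t + B)) 0 : R.
have h0 s : 0 <= h s by rewrite le_max lexx orbT.
have hnd : {homo h : a b / a <= b}.
  by move=> a b ab; apply: le_max2 => //; rewrite lerB.
have ht s : s <= t -> h s = 0.
  by move=> st; rewrite /h max_r// subr_le0 (le_trans st)// lerDl ltW.
have hl a b : `|h a - h b| <= 1 * `|a - b|.
  rewrite mul1r; wlog ba : a b / b <= a => [hw|].
    have [/hw//|/ltW /hw hh] := leP b a.
    by rewrite distrC [`|a - b|]distrC.
  rewrite !ger0_norm ?subr_ge0//; last exact: hnd.
  rewrite lerBlDr /h /Num.max.
  by repeat case: ifPn; rewrite ?ltNge ?negbK; lra.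
have mh : measurable_fun setT h by exact: nondecreasing_measurable.
have := trunc hnd ht hl.
rewrite -[X in (X <= _)%E]/(\int[lam]_x (v x * h `|w x|)%:E)%E => key.
have mhw : measurable_fun setT (fun x => h `|w x|) by meas.
have key2 : (\int[lam]_x (h `|w x| ^+ 2 + B * h `|w x|)%:E <=
    \int[lam]_x (B * h `|w x|)%:E)%E.
  apply: (@le_trans _ _ (\int[lam]_x (v x * h `|w x|)%:E)%E).
    apply: nneg_le_integral => //; [by meas|by meas| |].
      by move=> x _; rewrite addr_ge0 ?sqr_ge0// mulr_ge0// ltW.
    move=> x _; rewrite expr2 -mulrDl.
    have [hx|hx] := leP (`|w x|) (t + B).
      by rewrite [h _](_ : _ = 0) ?mulr0// /h max_r// subr_le0.
    apply: ler_wpM2r => //; rewrite /h max_l; last by rewrite subr_ge0 ltW.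
    by rewrite /v le_max; apply/orP; left; rewrite opprD addrA subrK.
  apply: le_trans key _.
  apply: ae_ge0_le_integral => //.
  - by move=> x _; rewrite lee_fin mulr_ge0.
  - by meas.
  - by move=> x _; rewrite lee_fin mulr_ge0// ltW.
  - by meas.
  by apply: filterS fB => x fx _; rewrite lee_fin ler_wpM2r.
(* The bound [h(|w|) <= |w| <= 1 + w^2] on [Om] reduces finiteness to the square integrability of
   [w]. *)
have Bfin : (\int[lam]_x (B * h `|w x|)%:E < +oo)%E.
  apply: (@le_lt_trans _ _ (\int[lam]_x (B * (1 * \1_Om x + w x ^+ 2))%:E)%E).
    have m1 : measurable_fun setT (\1_Om : _ -> R) by exact: measurable_indic.
    apply: nneg_le_integral => //; [by meas|by meas|by move=> x _; rewrite mulr_ge0// ltW|].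
    move=> x _; apply: ler_wpM2l; first exact: ltW.
    rewrite mul1r indicE; have [xO|xO] := boolP (x \in Om); last first.
      rewrite w0 ?normr0; last by move: xO; rewrite notin_setE.
      by rewrite ht// expr0n addr0.
    have := sqr_ge0 (`|w x| - 1); rewrite sqrrB1 real_normK ?num_real// => h1.
    have h2 : h `|w x| <= `|w x|.
      by rewrite /h ge_max normr_ge0 andbT gerBl addr_ge0// ltW.
    apply: le_trans h2 _; have := normr_ge0 (w x); rewrite mulr1n.
    by move: h1; rewrite -mulr_natr; lra.
  have m1 : measurable_fun setT (\1_Om : _ -> R) by exact: measurable_indic.
  have i0 x : 0 <= \1_Om x :> R by rewrite indicE.
  rewrite nneg_integralZ; [|by meas|by move=> x; rewrite addr_ge0 ?sqr_ge0// mul1r|exact: ltW].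
  apply: lte_mul_pinfty; rewrite ?lee_fin ?ltW//.
  rewrite nneg_integralD; [|by meas|by meas|by move=> x; rewrite mul1r|by move=> x; exact: sqr_ge0].
  by rewrite integral_scaled_indic// lte_add_pinfty// ltry.
rewrite nneg_integralD in key2; [|by meas|by meas|by move=> x; exact: sqr_ge0|
  by move=> x; rewrite mulr_ge0// ltW].
have H0 : (\int[lam]_x (h `|w x| ^+ 2)%:E = 0)%E.
  have : (0 <= \int[lam]_x (B * h `|w x|)%:E)%E.
    by apply: integral_ge0 => x _; rewrite lee_fin mulr_ge0// ltW.
  have : (0 <= \int[lam]_x (h `|w x| ^+ 2)%:E)%E.
    by apply: integral_ge0 => x _; rewrite lee_fin sqr_ge0.
  move: key2 Bfin; set X := integral _ _ _; set Y := integral _ _ _.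
  case: X => [a| |]//; case: Y => [b| |]//.
  rewrite -EFinD !lee_fin => ab _ a_ge0 b_ge0; congr EFin; apply/eqP.
  by rewrite eq_le a_ge0 andbT; lra.
have /ae_eq_integral_abs : (\int[lam]_x `|(h `|w x| ^+ 2)%:E| = 0)%E.
  by rewrite -[RHS]H0; apply: eq_integral => x _; rewrite gee0_abs// lee_fin sqr_ge0.
move=> /(_ measurableT).
have mh2 : measurable_fun setT (fun x => (h `|w x| ^+ 2)%:E) by meas.
move=> /(_ mh2); apply: filterS => x /(_ I) /= /eqP.
rewrite eqe sqrf_eq0 /h => /eqP hx.
by rewrite -subr_le0 -hx le_max lexx.
Qed.

End LpBounds.

(** * Choice of the truncation level and assembly of the bounds *)

Section Conclusion.
Set Implicit Arguments. Unset Strict Implicit.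
Context {R : realType} {N : nat}.
Context (lam : {sigma_finite_measure set (N.-tuple R) -> \bar R}).

Lemma chebyshev_sqr (w : N.-tuple R -> R) (t : R) : measurable_fun setT w -> 0 <= t ->
  ((t ^+ 2)%:E * lam [set x | (t < `|w x|)%R] <= \int[lam]_x (w x ^+ 2)%:E)%E.
Proof.
move=> mw t0; set A := [set x | _].
have mA : measurable A by exact: measurable_norm_gt.
have -> : lam A = (\int[lam]_x (\1_A x)%:E)%E by rewrite integral_indic// setIT.
have m1 : measurable_fun setT (\1_A : _ -> R) by exact: measurable_indic.
rewrite -nneg_integralZ//; last exact: sqr_ge0.
apply: nneg_le_integral => //; [by meas|by meas| |].
  by move=> x _; rewrite mulr_ge0// ?sqr_ge0// indicE.
move=> x _; rewrite indicE; have [xA|xA] := boolP (x \in A); last first.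
  by rewrite mulr0 sqr_ge0.
rewrite mulr1 -[leRHS]real_normK ?num_real// lerXn2r ?nnegrE//.
by move: xA; rewrite inE => /ltW.
Qed.

Lemma small_superlevel (w : N.-tuple R -> R) (t Q : R) (n : nat) :
  measurable_fun setT w -> 0 < t -> (\int[lam]_x (w x ^+ 2)%:E <= Q%:E)%E ->
  n%:R * Q <= t ^+ 2 ->
  (n%:R%:E * lam [set x | (t < `|w x|)%R] <= 1)%E.
Proof.
move=> mw t0 wQ nQ; have := le_trans (chebyshev_sqr mw (ltW t0)) wQ.
have : (0 <= lam [set x | (t < `|w x|)%R])%E by exact: measure_ge0.
have t2 : 0 < t ^+ 2 by rewrite exprn_gt0.
(* Infinite measure is excluded: [t^2 > 0] and [Q] is finite. *)
case: (lam _) => [r| |]//; last first.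
  by rewrite gt0_muley ?lte_fin// leye_eq.
rewrite -!EFinM !lee_fin => r0 rQ.
rewrite -(ler_pM2r t2) mul1r; apply: le_trans nQ.
by rewrite -mulrA ler_wpM2l// mulrC.
Qed.

Context (Om : set (N.-tuple R)).
Hypothesis mOm : measurable Om.
Hypothesis Om_fin : (lam Om < +oo)%E.

(** Pointwise [|w| <= v + c B <= 2 max(v, c B)]. Integrating over [Om] gives [2^p (1 + c^p V) B^p],
    and the bracket is at most [((1 + c) (1 + V))^p], so the [p]-th root leaves a constant free of
    [p]. *)
Lemma powR_le_of_trunc (w : N.-tuple R -> R) (p c B : R) : measurable_fun setT w ->
  (forall x, ~ Om x -> w x = 0) -> 2 <= p -> 0 <= c -> 0 <= B ->
  (\int[lam]_x (Num.max (`|w x| - c * B) 0 `^ p)%:E <= (B `^ p)%:E)%E ->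
  (\int[lam]_x (`|w x| `^ p)%:E <=
   ((2 * (1 + c) * (1 + fine (lam Om)) * B) `^ p)%:E)%E.
Proof.
move=> mw w0 p2 c0 B0 vB; set V := fine (lam Om).
have V0 : 0 <= V by rewrite fine_ge0.
have p0 : 0 <= p by lra.
have p1 : 1 <= p by lra.
have cB : 0 <= c * B by rewrite mulr_ge0.
have m1 : measurable_fun setT (\1_Om : _ -> R) by exact: measurable_indic.
pose v x := Num.max (`|w x| - c * B) 0.
have mv : measurable_fun setT v by rewrite /v; meas.
have v0 x : 0 <= v x by rewrite le_max lexx orbT.
apply: (@le_trans _ _ (\int[lam]_x
    (2 `^ p * (v x `^ p) + 2 `^ p * (c * B) `^ p * \1_Om x)%:E)%E).
  apply: nneg_le_integral => //; [by meas|by meas|].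
  move=> x _; rewrite indicE; have [xO|xO] := boolP (x \in Om); last first.
    rewrite w0; last by move: xO; rewrite notin_setE.
    by rewrite normr0 powR0 ?gt_eqF ?mulr0 ?addr0 ?mulr_ge0 ?powR_ge0//; lra.
  rewrite mulr1 -mulrDr.
  have wv : `|w x| <= v x + c * B by rewrite -lerBlDr /v le_max lexx.
  pose m := Num.max (v x) (c * B).
  have m0 : 0 <= m by rewrite le_max v0.
  have wm : `|w x| <= 2 * m.
    apply: le_trans wv _; rewrite mulr_natl mulr2n lerD//.
      by rewrite le_max lexx.
    by rewrite le_max lexx orbT.
  apply: (@le_trans _ _ ((2 * m) `^ p)).
    by apply: ge0_ler_powR; rewrite ?nnegrE// mulr_ge0.
  rewrite (powRM _ (ler0n R 2) m0); apply: ler_wpM2l; first exact: powR_ge0.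
  rewrite /m; have [_|_] := leP (v x) (c * B).
    by rewrite lerDr powR_ge0.
  by rewrite lerDl powR_ge0.
rewrite nneg_integralD; [|by meas|by meas|by move=> x; rewrite mulr_ge0// powR_ge0|
  by move=> x; rewrite !mulr_ge0 ?powR_ge0// indicE].
rewrite integral_scaled_indic//; last by rewrite mulr_ge0 ?powR_ge0.
rewrite nneg_integralZ; [|by meas|by move=> x; exact: powR_ge0|exact: powR_ge0].
apply: (@le_trans _ _ ((2 `^ p)%:E * (B `^ p)%:E + (2 `^ p * (c * B) `^ p * V)%:E)%E).
  by apply: leeD => //; apply: lee_wpmul2l => //; rewrite lee_fin powR_ge0.
rewrite -EFinM -EFinD lee_fin.
have c1 : 0 <= 1 + c by lra.
have V1 : 0 <= 1 + V by lra.
rewrite !powRM ?mulr_ge0//.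
have h1 : 1 <= (1 + c) `^ p by rewrite -{1}(powRr0 (1 + c)); apply: ler_powR => //; lra.
have h2 : c `^ p <= (1 + c) `^ p by apply: ge0_ler_powR; rewrite ?nnegrE//; lra.
have h3 : 1 + V <= (1 + V) `^ p.
  by rewrite -{1}(powRr1 V1); apply: ler_powR => //; lra.
have -> : 2 `^ p * B `^ p + 2 `^ p * (c `^ p * B `^ p) * V =
  2 `^ p * (1 + c `^ p * V) * B `^ p by ring.
apply: ler_wpM2r; first exact: powR_ge0.
rewrite -mulrA; apply: ler_wpM2l; first exact: powR_ge0.
apply: (@le_trans _ _ ((1 + c) `^ p * (1 + V))).
  by rewrite mulrDr mulr1; apply: lerD => //; apply: ler_wpM2r.
by apply: ler_wpM2l => //; exact: powR_ge0.
Qed.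

Context (J : N.-tuple R -> N.-tuple R -> R).

(* A positive upper bound [B] of the norm of [f] replaces the norm itself, which
   may vanish: the level of truncation is a multiple of [B]. *)
Lemma uniform_Lp_bound : is_lebesgue_measure lam -> (1 <= N)%N -> ebounded Om ->
  H0 lam J -> kernel_hyps lam J ->
  exists2 C : R, 0 < C & forall (p : \bar R) (B : R) (f u : N.-tuple R -> R),
    (2%:E <= p)%E -> 0 < B -> measurable_fun Om f ->
    weak_solution lam J Om f u -> (LpnormOn lam Om p f <= B%:E)%E ->
    (LpnormOn lam Om p u <= (C * B)%:E)%E.
Proof.
move=> Hlam N1 Om_bdd [mJ J0 Jsym _] [K [[mK K0 KJ Kni] _]].
(* Of the mass [3], at most [1] is lost on the superlevel set and [2] remain off it. *)
have [n [D [mD Kn Di K3]]] := exists_kernel_core Hlam N1 3 mK K0 (Kni 1 ltr01).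
pose k z := K z * \1_D z.
have mk : measurable_fun setT k.
  by apply: measurable_funM => //; exact: measurable_indic.
have kD z : ~ D z -> k z = 0 by move=> Dz; rewrite /k indicE memNset// mulr0.
have kn z : 0 <= k z <= n%:R.
  have [Dz|/kD ->] := pselect (D z); last by rewrite lexx ler0n.
  by rewrite /k indicE mem_set// mulr1 K0 Kn.
have k0 z : 0 <= k z by have /andP[] := kn z.
have k3 : (3%:E <= \int[lam]_z (k z)%:E)%E.
  apply: le_trans K3 _; rewrite integral_mkcond le_eqVlt; apply/orP; left; apply/eqP.
  apply: eq_integral => z _; rewrite patchE /k indicE.
  by case: (z \in D); rewrite ?mulr1 ?mulr0.
(* Symmetry of [J] reconciles the orientation [y - x] with the lower bound by [K]. *)
have kJ x y : k (vsub y x) <= J x y.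
  rewrite Jsym; apply: le_trans (KJ y x).
  by rewrite /k indicE ler_piMr//; case: (_ \in _).
have [C C0 poin] := poincare Hlam mOm Om_bdd Di.
pose V := fine (lam Om).
have V0 : 0 <= V by rewrite fine_ge0.
(* Chosen so that [n C^2 (V + 1) <= c^2]: the level [c B] then makes the superlevel set as small as
   [weak_solution_truncation] requires. *)
pose c := C * (V + 1) * n.+1%:R.
have c0 : 0 < c by rewrite !mulr_gt0//; lra.
exists (2 * (1 + c) * (1 + V)) => [|p B f u p2 B0 mf wfu fB].
  by rewrite !mulr_gt0//; lra.
pose w := zero_off Om u.
have ww : weak_solution lam J Om f w by exact: weak_solution_zero_off.
have w0 x : ~ Om x -> w x = 0 by exact: zero_off_out.
have mw : measurable_fun setT w by have [[]] := ww.
have w2 := weak_solution_L2 mOm mJ mk kn k3 kJ mf w0 ww C0 (poin k w mk k0 kD mw w0).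
have f2 := LpnormOn_L2 mOm Om_fin p2 B0 mf fB.
have wQ : (\int[lam]_x (w x ^+ 2)%:E <= (C ^+ 2 * (B ^+ 2 * (V + 1)))%:E)%E.
  apply: le_trans w2 _; rewrite [leRHS]EFinM; apply: lee_wpmul2l => //.
  by rewrite lee_fin sqr_ge0.
have t0 : 0 < c * B by exact: mulr_gt0.
have nA := small_superlevel (n := n) mw t0 wQ.
have {nA}/nA : n%:R * (C ^+ 2 * (B ^+ 2 * (V + 1))) <= (c * B) ^+ 2.
  have -> : (c * B) ^+ 2 = (n.+1%:R ^+ 2 * (V + 1)) * (C ^+ 2 * (B ^+ 2 * (V + 1))).
    by rewrite /c; ring.
  apply: ler_wpM2r; first by rewrite !mulr_ge0 ?sqr_ge0//; lra.
  rewrite -natr1; have := ler0n R n; set r := n%:R => r0.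
  by nra.
move=> nA.
have trunc h L hnd ht hl :=
  @weak_solution_truncation _ _ _ Hlam _ mOm _ mJ J0 _ _ mk kn k3 kJ _ _ mf w0 ww
    h (c * B) L (ltW t0) hnd ht hl nA.
have uw : zero_off Om u = w by [].
case: p p2 fB => [p| |]//; last first.
  move=> _ /ae_le_LpnormOn_infty fB.
  have w2fin : (\int[lam]_x (w x ^+ 2)%:E < +oo)%E.
    by apply: le_lt_trans wQ _; rewrite ltry.
  have := ae_le_trunc mOm Om_fin mf mw w0 (ltW t0) trunc B0 w2fin fB.
  move=> wB; apply: LpnormOn_infty_le; first by rewrite !mulr_ge0//; lra.
  apply: filterS wB => x; rewrite uw => /le_trans; apply.
  (* The sup bound [1 + c] is below the constant common to all [p]. *)
  have -> : c * B + B = (1 + c) * B by ring.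
  apply: ler_wpM2r; first exact: ltW.
  by nra.
rewrite lee_fin => p2 fB.
have p0 : 0 < p by lra.
apply: LpnormOn_le => //; first by rewrite !mulr_ge0//; lra.
rewrite uw; apply: powR_le_of_trunc => //; [exact: ltW|exact: ltW|].
apply: (trunc_powR_le mOm Om_fin mf mw w0 (ltW t0) trunc) => //; first exact: ltW.
by apply: integral_le_LpnormOn => //; exact: ltW.
Qed.

End Conclusion.

Theorem mainTheorem15 (R : realType) (N : nat) (N_ge1 : (1 <= N)%N)
  (lam : {sigma_finite_measure set (N.-tuple R) -> \bar R})
  (Hlam : is_lebesgue_measure lam)
  (Om : set (N.-tuple R)) (Om_open : eopen Om) (Om_bdd : ebounded Om)
  (J : N.-tuple R -> N.-tuple R -> R)
  (HJ0 : H0 lam J) (HJ : kernel_hyps lam J) :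
  exists C : R, forall p : \bar R, (2%:E <= p)%E ->
    forall f u : N.-tuple R -> R,
      in_Lp lam Om p f -> weak_solution lam J Om f u ->
      (LpnormOn lam Om p u <= C%:E * LpnormOn lam Om p f)%E.
Proof.
have mOm := measurable_eopen Om_open.
have [C C0 bound] :=
  uniform_Lp_bound mOm (lebesgue_bounded_fin Hlam mOm Om_bdd) Hlam N_ge1 Om_bdd HJ0 HJ.
exists C => p p2 f u [mf ffin] wfu.
have F0 : (0 <= LpnormOn lam Om p f)%E by exact: Lnorm_ge0.
(* The bound [B] is the norm of [f] plus [e / C]: it is positive even when the norm vanishes, and
   the excess becomes exactly [e] after multiplication by [C]. *)
apply/lee_addgt0Pr => e e0.
have F_fin : LpnormOn lam Om p f \is a fin_num by rewrite ge0_fin_numE.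
have B0 : 0 < fine (LpnormOn lam Om p f) + e / C.
  by rewrite ltr_wpDl ?divr_gt0// fine_ge0.
apply: le_trans (bound p _ f u p2 B0 mf wfu _) _.
  by rewrite EFinD fineK// leeDl// lee_fin divr_ge0// ltW.
by rewrite mulrDr (mulrC C (e / C)) divfK ?gt_eqF// EFinD EFinM fineK.
Qed.
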